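(* Let $n\ge1$, $N=2^n-1$, and let $\mathbf P=(\Delta_{T_1},\ldots,\Delta_{T_N})$, where $T_1,\ldots,T_N$ are all the nonempty subsets of $[n]$ ordered so that $T_N=[n]$. Let $(\mathcal J^{(1)},\ldots,\mathcal J^{(m)})$ be a fine mixed subdivision of $\mathbf P$, with $\mathcal J^{(k)}=(J^{(k)}_1,\dots,J^{(k)}_N)$. Then $$\frac{n!}{(2^1-1)(2^2-1)\cdots(2^{n-1}-1)}=(2^n-2)\sum_{k:\,|J^{(k)}_N|>1}\ \prod_{i:\,|J^{(k)}_i|>1}\ \prod_{j\in J^{(k)}_i}\frac{1}{\alpha^{(k)}_{i,\bar j}}\;+\sum_{k:\,|J^{(k)}_N|=1}\ \prod_{i:\,|J^{(k)}_i|>1}\ \prod_{j\in J^{(k)}_i}\frac{1}{\alpha^{(k)}_{i,\bar j}} .$$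
   Context: $\Delta_T=\mathrm{conv}(\mathbf e_i\mid i\in T)\subset\mathbb{R}^n$. For a sequence $\mathcal J=(J_1,\dots,J_N)$ of nonempty subsets $J_i\subseteq T_i$, $G_{\mathcal J}$ is the bipartite graph on the vertex set $\{1,\dots,N\}\sqcup\{\bar1,\dots,\bar n\}$ with an edge $(i,\bar j)$ whenever $j\in J_i$. A fine mixed subdivision of $\mathbf P$ is a collection of distinct sequences $\mathcal J^{(1)},\dots,\mathcal J^{(m)}$ (encoding the cells $(\Delta_{J_1},\dots,\Delta_{J_N})$) such that each $\Delta_{J_1}+\cdots+\Delta_{J_N}$ has dimension $n-1=\sum_i(|J_i|-1)$ and the cells fit together properly as labelled Minkowski sums covering $\sum_i\Delta_{T_i}$; precisely (by the Cayley trick) the simplices $\mathrm{conv}\{(\mathbf e_j,\mathbf f_i): j\in J^{(k)}_i,\ 1\le i\le N\}\subset\mathbb{R}^n\times\mathbb{R}^N$, $k=1,\dots,m$ ($\mathbf f_i$ the standard basis of $\mathbb{R}^N$), form a triangulation of $\mathrm{conv}\{(\mathbf e_j,\mathbf f_i): j\in T_i,\ 1\le i\le N\}$. In this case each $G_{\mathcal J^{(k)}}$ is a tree spanning all $N+n$ vertices. For an edge $(i,\bar j)$ of $G_{\mathcal J^{(k)}}$, delete the vertex $i$ and its incident edges and let $A^{(k)}_{i,\bar j}\subseteq[N]$ be the set of unbarred vertices in the connected component containing $\bar j$. Define $\alpha^{(k)}_{i,\bar j}=|A^{(k)}_{i,\bar j}|$ if $N\notin A^{(k)}_{i,\bar j}$,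 and $\alpha^{(k)}_{i,\bar j}=2^n-1-|A^{(k)}_{i,\bar j}|$ otherwise. *)

(* Defs.v *)
From HB Require Import structures.
From mathcomp Require Import all_boot all_order all_algebra.
From mathcomp Require Import all_classical all_reals.

Set Implicit Arguments.
Unset Strict Implicit.
Unset Printing Implicit Defensive.

Import Order.TTheory GRing.Theory Num.Theory.

Local Open Scope classical_set_scope.
Local Open Scope ring_scope.

(* Convention: [n] and [N] are 'I_n and 'I_N (0-based), so that the index N of
   the last summand is the ordinal with value N - 1. *)

(* Convex hull of the points p t, t \in A; it is empty when A is empty. *)
Definition conv (R : realType) (d : nat) (I : finType) (p : I -> 'rV[R]_d)
    (A : {set I}) : set 'rV[R]_d :=
  [set x | exists c : I -> R,
     [/\ forall t, t \in A -> 0 <= c t,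
         \sum_(t in A) c t = 1 &
         x = \sum_(t in A) c t *: p t]].

Definition affinely_independent (R : realType) (d : nat) (I : finType)
    (p : I -> 'rV[R]_d) (A : {set I}) : Prop :=
  forall c : I -> R,
    \sum_(t in A) c t = 0 -> \sum_(t in A) c t *: p t = 0 ->
    forall t, t \in A -> c t = 0.

(* S is nonempty and its affine span has dimension k; W is the direction of
   that span, i.e. the least subspace containing all differences of S. *)
Definition has_dim (R : realType) (d : nat) (S : set 'rV[R]_d) (k : nat) :
    Prop :=
  S !=set0 /\
  exists W : {vspace 'rV[R]_d}, (\dim W = k)%N /\
    forall U : {vspace 'rV[R]_d},
      (W <= U)%VS <-> (forall x y, S x -> S y -> x - y \in U).

(* The family of simplices conv p (A k), each given by its vertex set A k, is
   (the list of maximal simplices of) a triangulation of conv p B using only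
   points of B as vertices. A face of a simplex is the hull of a subset of its
   vertices, possibly empty. *)
Definition is_triangulation (R : realType) (d : nat) (I : finType)
    (p : I -> 'rV[R]_d) (B : {set I}) (m : nat) (A : 'I_m -> {set I}) : Prop :=
  [/\ forall k, A k \subset B,
      forall k, affinely_independent p (A k),
      exists e, has_dim (conv p B) e /\ forall k, has_dim (conv p (A k)) e,
      conv p B = \bigcup_k conv p (A k) &
      forall k l, k != l -> exists F : {set I},
        [/\ F \subset A k, F \subset A l &
            conv p (A k) `&` conv p (A l) = conv p F]].

Definition simplex (R : realType) (n : nat) (S : {set 'I_n}) : set 'rV[R]_n :=
  conv (fun j : 'I_n => delta_mx 0 j) S.
Arguments simplex R {n} S.

Definition minkowski_sum (R : realType) (n N : nat)
    (S : 'I_N -> set 'rV[R]_n) : set 'rV[R]_n :=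
  [set x | exists y : 'I_N -> 'rV[R]_n,
     (forall i, S i (y i)) /\ x = \sum_i y i].

(* The point (e_j, f_i) of R^n x R^N, for t = (i, j). *)
Definition cayley_point (R : realType) (n N : nat) (t : 'I_N * 'I_n) :
    'rV[R]_(n + N) :=
  row_mx (delta_mx 0 t.2) (delta_mx 0 t.1).

Definition incidences (n N : nat) (J : 'I_N -> {set 'I_n}) :
    {set 'I_N * 'I_n} :=
  [set t | t.2 \in J t.1]%SET.

Definition fine_mixed_subdivision (R : realType) (n N : nat)
    (T : 'I_N -> {set 'I_n}) (m : nat)
    (J : 'I_m -> {ffun 'I_N -> {set 'I_n}}) : Prop :=
  [/\ injective J,
      forall k i, J k i != finset.set0 /\ J k i \subset T i,
      forall k, has_dim (minkowski_sum (fun i => simplex R (J k i))) (n - 1),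
      forall k, (\sum_i (#|J k i| - 1) = n - 1)%N &
      is_triangulation (@cayley_point R n N) (incidences T)
        (fun k => incidences (J k))].

(* The bipartite graph G_J: inl i is the vertex i and inr j the vertex \bar j. *)
Definition bip_graph (n N : nat) (J : 'I_N -> {set 'I_n}) : rel ('I_N + 'I_n) :=
  fun u v => match u, v with
             | inl i, inr j => j \in J i
             | inr j, inl i => j \in J i
             | _, _ => false
             end.

Definition delete_vertex (V : finType) (e : rel V) (x : V) : rel V :=
  fun u v => [&& u != x, v != x & e u v].

Definition comp_set (n N : nat) (J : 'I_N -> {set 'I_n}) (i : 'I_N)
    (j : 'I_n) : {set 'I_N} :=
  [set l : 'I_N |
    connect (delete_vertex (bip_graph J) (inl i)) (inr j) (inl l)]%SET.

(* [last] stands for the index N of the summand T_N. *)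
Definition alpha (n N : nat) (last : 'I_N) (J : 'I_N -> {set 'I_n})
    (i : 'I_N) (j : 'I_n) : nat :=
  if last \notin comp_set J i j then #|comp_set J i j|
  else (2 ^ n - 1 - #|comp_set J i j|)%N.

(* Main.v *)
(* Idea. Deleting an edge e of the tree G_k cuts off from the root, the vertex
   of T_N, a part containing alpha_e unbarred vertices, so up to the factor
   2^n - 2 the right-hand side is the sum over k of prod_(e in G_k) 1 / alpha_e.
   By the hook formula for rooted trees, each product is a sum over the total
   orders on the non-root vertices in which every vertex lies below its parent
   in G_k, an order being weighted by the inverses of the numbers of unbarred
   vertices in its lower sets.
     The point is that an order is compatible with exactly one k if every
   i <> N lies below some j in T_i, and with none otherwise. Label each edge of
   the Cayley polytope by its lower endpoint: G_k is compatible with the order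
   iff its edges carry distinct labels, so this is a count of fully labelled
   simplices in a triangulation, as in Sperner's lemma. Moving one vertex i
   past one j changes the label of a single edge, and the change in the count
   is a sum over facets containing that edge, in which the two simplices at an
   interior facet cancel and no boundary facet contributes. Once all the i are
   at the bottom, the only compatible tree has J_N = [n].
     The remaining sum over orders is evaluated by removing maximal elements. *)
Require Import Defs.
From mathcomp Require Import all_boot all_order all_algebra fingroup perm zify ring.
From mathcomp Require Import all_classical all_reals.

Set Implicit Arguments.
Unset Strict Implicit.
Unset Printing Implicit Defensive.

Import Order.TTheory GRing.Theory Num.Theory.

Local Open Scope ring_scope.

(** * Determinants and pairings of rows with columns *)

Section Determinants.
Local Open Scope set_scope.

(** A permutation with a nonzero product never lowers the height and raises it at every moved index.
    Since a permutation preserves the sum of all heights, only the identity survives, and no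
    rearrangement into triangular form is needed. *)
Lemma det_height_triangular (F : comNzRingType) (d : nat) (h : 'I_d -> nat)
    (A : 'M[F]_d) :
  (forall r c, r != c -> A r c != 0 -> (h r < h c)%N) ->
  \det A = \prod_r A r r.
Proof.
move=> hA; rewrite /determinant (bigD1 (1%g : {perm 'I_d})) //= [X in _ + X]big1 ?addr0.
  by rewrite odd_perm1 expr0 mul1r; apply: eq_bigr => r _; rewrite perm1.
move=> s s1; case: (boolP [exists r, A r (s r) == 0]) => [/existsP[r /eqP Ar]|].
  by rewrite (bigD1 r) //= Ar mul0r mulr0.
rewrite negb_exists => /forallP As.
have le_h r : (h r <= h (s r))%N.
  by case: (eqVneq r (s r)) => [<- //|rs]; apply: ltnW; apply: hA (As r).
have [r rs] : exists r, s r != r.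
  apply/existsP; apply: contraR s1; rewrite negb_exists => /forallP s1.
  by apply/eqP/permP => r; rewrite perm1; apply/eqP; rewrite -[_ == _]negbK.
have lt_h : (\sum_r h r < \sum_r h (s r))%N.
  rewrite (bigD1 r) //= [X in (_ < X)%N](bigD1 r) //= -addSn leq_add //.
    by apply: hA (As r); rewrite eq_sym.
  by apply: leq_sum.
by move: lt_h; rewrite [X in (_ < X)%N](reindex_inj (@perm_inj _ (s^-1)%g)) /=;
  under [X in (_ < X)%N]eq_bigr do rewrite permKV; rewrite ltnn.
Qed.

(** Matrix determinant lemma: the block matrix with rows [1, u] and [-y, 1] has two block triangular
    factorizations. *)
Lemma det_1D_rank1 (F : comNzRingType) (d : nat) (u : 'cV[F]_d)
    (y : 'rV[F]_d) : \det (1%:M + u *m y) = 1 + (y *m u) 0 0.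
Proof.
have e1 : block_mx 1%:M u (- y) 1%:M =
   block_mx 1%:M 0 (- y) 1%:M *m block_mx 1%:M u 0 (1%:M + y *m u).
  by rewrite mulmx_block !(mulmx1, mul1mx, mulmx0, mul0mx, addr0) mulNmx
    addrCA addNr addr0.
have e2 : block_mx 1%:M u (- y) 1%:M =
   block_mx 1%:M u 0 1%:M *m block_mx (1%:M + u *m y) 0 (- y) 1%:M.
  by rewrite mulmx_block !(mulmx1, mul1mx, mulmx0, mul0mx, addr0, add0r) mulmxN
    addrK.
have := congr1 determinant e1; rewrite {1}e2 !det_mulmx !det_ublock !det_lblock.
by rewrite !det1 !(mul1r, mulr1) => ->; rewrite det_mx11 !mxE.
Qed.

Lemma det_replace_row (F : comNzRingType) (d : nat) (w : 'I_d -> 'rV[F]_d) r x :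
  \det (\matrix_s (if s == r then x else w s)) =
  (x *m \adj (\matrix_s w s)) 0 r.
Proof.
rewrite (expand_det_row _ r) mxE; apply: eq_bigr => c _.
rewrite !mxE eqxx; congr (_ * (_ * \det _)); apply/matrixP => s t.
by rewrite !mxE eq_sym (negPf (neq_lift _ _)).
Qed.

Lemma det_mulmx0 (F : fieldType) (d : nat) (A : 'M[F]_d) (y : 'cV[F]_d) :
  A *m y = 0 -> y != 0 -> \det A = 0.
Proof.
move=> Ay; apply: contraNeq => nzA.
have uA : A \in unitmx by rewrite unitmxE unitfE.
by rewrite -[y]mul1mx -(mulVmx uA) -mulmxA Ay mulmx0.
Qed.

Lemma row_mul_col (F : comNzRingType) (p q : nat) (x : 'rV[F]_p) (A : 'M[F]_(p, q)) r :
  (x *m col r A) 0 0 = (x *m A) 0 r.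
Proof. by rewrite !mxE; apply: eq_bigr => i _; rewrite mxE. Qed.

Lemma dotZl (F : comNzRingType) (p : nat) a (x : 'rV[F]_p) (y : 'cV[F]_p) :
  (a *: x *m y) 0 0 = a * (x *m y) 0 0.
Proof. by rewrite -scalemxAl mxE. Qed.

Lemma dotDl (F : comNzRingType) (p : nat) (x x' : 'rV[F]_p) (y : 'cV[F]_p) :
  ((x + x') *m y) 0 0 = (x *m y) 0 0 + (x' *m y) 0 0.
Proof. by rewrite mulmxDl mxE. Qed.

Lemma dotBl (F : comNzRingType) (p : nat) (x x' : 'rV[F]_p) (y : 'cV[F]_p) :
  ((x - x') *m y) 0 0 = (x *m y) 0 0 - (x' *m y) 0 0.
Proof. by rewrite -scaleN1r dotDl dotZl mulN1r. Qed.

Lemma dot_suml (F : comNzRingType) (p : nat) (I : finType) (A : {pred I})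
    (x : I -> 'rV[F]_p) (y : 'cV[F]_p) :
  ((\sum_(i in A) x i) *m y) 0 0 = \sum_(i in A) (x i *m y) 0 0.
Proof. by rewrite mulmx_suml summxE. Qed.

End Determinants.

(** * Weighted sums over linear orders *)

Section Orderings.
Local Open Scope set_scope.
Variables (R : realFieldType) (n N : nat).
Local Notation V := ('I_N + 'I_n)%type.
Implicit Types (X : {set V}) (ok : {set V} -> pred V).

(** The number [p] is fuel for the recursion; for [p = #|X|] the argument of [F] runs through all
    orderings of [X]. *)
Fixpoint order_sum (p : nat) X (F : seq V -> R) : R :=
  if p is p'.+1 then \sum_(x in X) order_sum p' (X :\ x) (fun s => F (x :: s))
  else F [::].

Lemma eq_order_sum p X F F' : #|X| = p ->
  (forall s, uniq s -> s =i X -> F s = F' s) ->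
  order_sum p X F = order_sum p X F'.
Proof.
elim: p X F F' => [|p IHp] X F F' cX eqF /=.
  by apply: eqF => // x; move/eqP: cX; rewrite cards_eq0 => /eqP ->; rewrite in_nil inE.
apply: eq_bigr => x xX; apply: IHp.
  by have := cardsD1 x X; rewrite xX cX => -[].
move=> s us sX; apply: eqF => /= [|y]; first by rewrite us sX !inE eqxx.
by rewrite inE sX !inE; case: eqP => [->|].
Qed.

Lemma order_sumZ p X c F :
  order_sum p X (fun s => c * F s) = c * order_sum p X F.
Proof.
elim: p X F => //= p IHp X F; rewrite mulr_sumr; apply: eq_bigr => x _.
exact: IHp.
Qed.

Lemma order_sum_sum p X (K : finType) (F : K -> seq V -> R) :
  order_sum p X (fun s => \sum_k F k s) = \sum_k order_sum p X (F k).
Proof.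
elim: p X F => //= p IHp X F; rewrite exchange_big /=; apply: eq_bigr => x _.
exact: IHp.
Qed.

Definition unbarred X : nat := #|[set l | inl l \in X]|.

(** Orders are listed from the largest element down, so at each call [X] is the lower set whose
    maximum is the head [x]. *)
Fixpoint admissible ok X (s : seq V) : bool :=
  if s is x :: s' then ok X x && admissible ok (X :\ x) s' else true.

Fixpoint order_weight X (s : seq V) : R :=
  if s is x :: s' then (unbarred X)%:R^-1 * order_weight (X :\ x) s' else 1.

Definition weighted_orders ok X : R :=
  order_sum #|X| X (fun s => (admissible ok X s)%:R * order_weight X s).

(** Orders are sorted by their largest element, whose removal leaves an order on the rest. *)
Lemma weighted_ordersE ok X : X != finset.set0 ->
  weighted_orders ok X =
  (unbarred X)%:R^-1 * \sum_(x in X | ok X x) weighted_orders ok (X :\ x).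
Proof.
move=> /set0Pn[x0 x0X]; rewrite /weighted_orders (cardsD1 x0) x0X /=.
rewrite big_mkcondr mulr_sumr; apply: eq_bigr => x xX.
have -> : #|X :\ x0| = #|X :\ x|.
  by have := cardsD1 x X; rewrite (cardsD1 x0 X) x0X xX => /addnI.
case: ifP => okx /=; last first.
  rewrite mulr0 -[RHS](mul0r (order_sum #|X :\ x| (X :\ x) (fun=> 1))).
  by rewrite -order_sumZ; apply: eq_order_sum => // s _ _; rewrite !mul0r.
rewrite -order_sumZ; apply: eq_order_sum => // s _ _.
by rewrite mulrCA.
Qed.

Lemma weighted_orders0 ok : weighted_orders ok finset.set0 = 1.
Proof. by rewrite /weighted_orders cards0 /= mul1r. Qed.

Lemma admissibleP ok X s : uniq s -> s =i X ->
  reflect (forall x, x \in X -> ok [set y in X | (index x s <= index y s)%N] x)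
    (admissible ok X s).
Proof.
elim: s X => [|x s IHs] X.
  by move=> _ X0; left => y; rewrite -X0.
rewrite cons_uniq => /andP[xs us] sX.
change (admissible ok X (x :: s)) with (ok X x && admissible ok (X :\ x) s).
have xX : x \in X by rewrite -sX inE eqxx.
have sX' : s =i X :\ x.
  by move=> y; rewrite !inE -sX inE; case: eqP => // ->; rewrite (negPf xs).
have Xx : [set y in X | (index x (x :: s) <= index y (x :: s))%N] = X.
  by apply/setP => y; rewrite !inE /= eqxx andbT.
have Xy y : y \in X :\ x ->
    [set z in X | (index y (x :: s) <= index z (x :: s))%N] =
    [set z in X :\ x | (index y s <= index z s)%N].
  move=> yX; apply/setP => z; rewrite !inE /=.
  have /negPf -> : x != y by move: yX; rewrite !inE eq_sym => /andP[].
  by rewrite (eq_sym z); case: (eqVneq x z) => [<-|_] /=; rewrite ?andbF ?ltnS.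
apply: (iffP andP) => [[okx /(IHs _ us sX') oks] y yX|oks].
  case: (eqVneq y x) => [->|yx]; first by rewrite Xx.
  by have yX' : y \in X :\ x; [rewrite !inE yx | rewrite Xy ?oks].
split; first by have := oks x xX; rewrite Xx.
apply/(IHs _ us sX') => y yX; rewrite -Xy //; apply: oks.
by move: yX; rewrite inE => /andP[].
Qed.

End Orderings.

(** * Spanning trees as bases of edge vectors, and their determinants *)

Section Trees.
Local Open Scope set_scope.
Variables (R : realFieldType) (n N : nat) (last : 'I_N).
Local Notation V := ('I_N + 'I_n)%type.
Local Notation E := ('I_N * 'I_n)%type.

Definition nonroot : {set V} := [set~ inl last].
Local Notation d := #|nonroot|.

(** Coordinates are indexed by the nonroot vertices only, so the root becomes 0 and the edge vectors
    are the rows of a reduced incidence matrix. *)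
Definition vtx (v : V) : 'rV[R]_d := \row_c (v == enum_val c)%:R.
Definition edge_vec (e : E) : 'rV[R]_d := vtx (inr e.2) - vtx (inl e.1).

Definition upd (w : E -> 'rV[R]_d) (e : E) (x : 'rV[R]_d) : E -> 'rV[R]_d :=
  fun f => if f == e then x else w f.

(** These are the edge sets of spanning trees on [V]. In this linear form, facts about trees are
    proved by testing edge vectors against functions on the vertices. *)
Definition cell (G : {set E}) : Prop :=
  #|G| = d /\ forall c : E -> R, \sum_(e in G) c e *: edge_vec e = 0 ->
    forall e, e \in G -> c e = 0.

(* [cell_det G w] is the determinant of the linear map sending [edge_vec e] to
   [w e] for e in G, hence does not depend on the enumeration of G *)
Definition cell_rows (G : {set E}) (w : E -> 'rV[R]_d) : 'M[R]_d :=
  \matrix_(r < d) nth 0 [seq w e | e <- enum G] r.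
Definition cell_det (G : {set E}) (w : E -> 'rV[R]_d) : R :=
  \det (cell_rows G w) / \det (cell_rows G edge_vec).

Lemma card_nonroot : d = (n + N).-1.
Proof. by rewrite cardsC1 card_sum !card_ord addnC. Qed.

Lemma vtx_root : vtx (inl last) = 0.
Proof.
apply/rowP => c; rewrite !mxE; case: eqP => // e.
by have := enum_valP c; rewrite -e !inE eqxx.
Qed.

(** A function on the vertices becomes a linear functional whose value on an edge vector is the
    difference of the function along the edge. *)
Lemma vtx_mul (f : V -> R) (v : V) :
  (vtx v *m \col_c (f (enum_val c) - f (inl last))) 0 0 = f v - f (inl last).
Proof.
rewrite mxE; case: (eqVneq v (inl last)) => [->|vL].
  by rewrite big1 ?subrr // => c _; rewrite vtx_root mxE mul0r.
have vin : v \in nonroot by rewrite !inE.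
rewrite (bigD1 (enum_rank_in vin v)) //= big1 ?addr0.
  by rewrite !mxE enum_rankK_in // eqxx mul1r.
move=> c cv; rewrite !mxE; case: eqP => [e|]; last by rewrite mul0r.
by case/negP: cv; rewrite [X in _ == X](congr1 (enum_rank_in vin) e) enum_valK_in.
Qed.

Lemma cell_enum G : cell G -> exists en : 'I_d -> E,
  [/\ injective en, G = [set en r | r : 'I_d] &
      forall w, cell_rows G w = \matrix_(r < d) w (en r)].
Proof.
case=> cG _; pose en r := enum_val (cast_ord (esym cG) r).
have en_inj : injective en by move=> r s /enum_val_inj /cast_ord_inj.
exists en; split=> //.
  apply/setP => e; apply/idP/imsetP => [eG|[r _ ->]]; last exact: enum_valP.
  exists (cast_ord cG (enum_rank_in eG e)) => //.
  by rewrite /en cast_ordK enum_rankK_in.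
move=> w; apply/row_matrixP => r; rewrite !rowK.
have lr : (r < size (enum G))%N by rewrite -cardE cG.
rewrite (nth_map (en r)) //; congr (w _).
by have := enum_val_nth (en r) (cast_ord (esym cG) r); rewrite -/(en r) => <-.
Qed.

Lemma cell_rows_unit G : cell G -> cell_rows G edge_vec \in unitmx.
Proof.
move=> cG; have [en [en_inj Gen rowsE]] := cell_enum cG.
rewrite rowsE unitmxE unitfE; apply/det0P => -[c c0 cM]; case/negP: c0.
apply/eqP/rowP => r; rewrite mxE.
pose c' e := \sum_s (e == en s)%:R * c 0 s.
have c'E s : c' (en s) = c 0 s.
  rewrite /c' (bigD1 s) //= eqxx mul1r big1 ?addr0 // => t ts.
  by rewrite (inj_eq en_inj) eq_sym (negPf ts) mul0r.
rewrite -c'E; apply: (cG.2 c'); last by rewrite Gen imset_f.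
rewrite Gen big_imset /=; last by move=> ? ? _ _; apply: en_inj.
rewrite -[RHS]cM mulmx_sum_row; apply: eq_bigr => s _.
by rewrite rowK c'E.
Qed.

Lemma cell_mapP G w : cell G -> exists M : 'M[R]_d,
  forall e, e \in G -> edge_vec e *m M = w e.
Proof.
move=> cG; have [en [en_inj Gen rowsE]] := cell_enum cG.
exists (invmx (cell_rows G edge_vec) *m cell_rows G w) => e.
rewrite {1}Gen => /imsetP[r _ ->].
have -> : edge_vec (en r) = row r (cell_rows G edge_vec) by rewrite rowsE rowK.
by rewrite -row_mul mulmxA mulmxV ?cell_rows_unit // mul1mx rowsE rowK.
Qed.

Lemma cell_det_map G w (M : 'M[R]_d) : cell G ->
  (forall e, e \in G -> edge_vec e *m M = w e) -> cell_det G w = \det M.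
Proof.
move=> cG hM; have [en [en_inj Gen rowsE]] := cell_enum cG.
have -> : cell_det G w =
   \det (cell_rows G edge_vec *m M) / \det (cell_rows G edge_vec).
  rewrite /cell_det; congr (\det _ / _); apply/row_matrixP => r.
  rewrite row_mul [cell_rows G edge_vec]rowsE rowsE !rowK hM //.
  by rewrite Gen imset_f.
rewrite det_mulmx mulrC mulKf //.
by have := cell_rows_unit cG; rewrite unitmxE unitfE.
Qed.

Lemma eq_cell_det (G : {set E}) (w w' : E -> 'rV[R]_d) : {in G, w =1 w'} -> cell G ->
  cell_det G w = cell_det G w'.
Proof.
move=> ww' cG; have [M hM] := cell_mapP w cG.
rewrite (cell_det_map cG hM); apply/esym/cell_det_map => // e eG.
by rewrite hM // ww'.
Qed.

Lemma cell_dual G : cell G -> exists phi : E -> 'cV[R]_d,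
  forall e f, e \in G -> f \in G ->
    (edge_vec e *m phi f) 0 0 = (e == f)%:R.
Proof.
move=> cG; case: (posnP d) => [d0|d_gt0].
  have G0 : G = finset.set0 by apply/eqP; rewrite -cards_eq0 cG.1 d0.
  by exists (fun=> 0) => e f; rewrite G0 inE.
have h f : exists y : 'cV[R]_d,
    forall e, e \in G -> (edge_vec e *m y) 0 0 = (e == f)%:R.
  (* Any single column of the map sending [f] to the all-ones vector and every other edge to 0 is
     dual to [f]; the case [d = 0] was split off because it has no column. *)
  have [M hM] := cell_mapP (fun e => (e == f)%:R *: const_mx 1) cG.
  exists (col (Ordinal d_gt0) M) => e eG.
  by rewrite row_mul_col hM // !mxE mulr1.
by have [phi hphi] := choice h; exists phi => e f eG fG; apply: hphi.
Qed.

Lemma cell_kernel G (y : 'cV[R]_d) : cell G ->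
  (forall e, e \in G -> (edge_vec e *m y) 0 0 = 0) -> y = 0.
Proof.
move=> cG hy; have [en [en_inj Gen rowsE]] := cell_enum cG.
rewrite -[y]mul1mx -(mulVmx (cell_rows_unit cG)) -mulmxA.
have -> : cell_rows G edge_vec *m y = 0.
  apply/row_matrixP => r; rewrite row_mul row0 rowsE rowK.
  by apply/rowP => c; rewrite ord1 hy ?mxE // Gen imset_f.
by rewrite mulmx0.
Qed.

Lemma cell_coord G (phi : E -> 'cV[R]_d) (x : 'rV[R]_d) : cell G ->
  (forall e f, e \in G -> f \in G ->
    (edge_vec e *m phi f) 0 0 = (e == f)%:R) ->
  x = \sum_(e in G) (x *m phi e) 0 0 *: edge_vec e.
Proof.
move=> cG hphi; apply/rowP => c.
set z := \sum_(_ in _) _.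
suff : (x - z) = 0 by move/eqP; rewrite subr_eq0 => /eqP ->.
have [en [en_inj Gen rowsE]] := cell_enum cG.
have uB := cell_rows_unit cG.
pose u := (x - z) *m invmx (cell_rows G edge_vec).
have xzE : x - z = \sum_r u 0 r *: edge_vec (en r).
  rewrite -[LHS]mulmx1 -(mulVmx uB) mulmxA -/u mulmx_sum_row.
  by apply: eq_bigr => r _; rewrite rowsE rowK.
have enG r : en r \in G by rewrite Gen imset_f.
have u0 r : u 0 r = 0.
  have : ((x - z) *m phi (en r)) 0 0 = 0.
    rewrite dotBl /z dot_suml (bigD1 (en r)) //= big1 ?addr0.
      by rewrite dotZl hphi // eqxx mulr1 subrr.
    by move=> e /andP[eG er]; rewrite dotZl hphi // (negPf er) mulr0.
  rewrite xzE dot_suml (bigD1 r) //= big1 ?addr0.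
    by rewrite dotZl hphi // eqxx mulr1.
  by move=> s sr; rewrite dotZl hphi // (inj_eq en_inj) (negPf sr) mulr0.
by rewrite xzE big1 // => r _; rewrite u0 scale0r.
Qed.

(** Linearity in one row, with scaled cofactors as coefficients. *)
Lemma cell_det_updE G w e : cell G -> e \in G -> exists y : 'cV[R]_d,
  forall x, cell_det G (upd w e x) = (x *m y) 0 0.
Proof.
move=> cG; have [en [en_inj Gen rowsE]] := cell_enum cG.
rewrite {1}Gen => /imsetP[r _ ->].
exists ((\det (cell_rows G edge_vec))^-1 *: col r (\adj (cell_rows G w))) => x.
rewrite -scalemxAr mxE mulrC row_mul_col /cell_det; congr (_ / _).
rewrite rowsE [cell_rows G w]rowsE -det_replace_row; congr (\det _).
by apply/matrixP => s t; rewrite !mxE /upd (inj_eq en_inj); case: eqP.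
Qed.

Lemma cell_det_updB G w e x x' : cell G -> e \in G ->
  cell_det G (upd w e x) - cell_det G (upd w e x') =
  cell_det G (upd w e (x - x')).
Proof.
move=> cG eG; have [y hy] := cell_det_updE w cG eG.
by rewrite !hy dotBl.
Qed.

(* Cramer's rule; with [s] the sum of the coordinates, this replaces the door
   counting of Sperner's lemma *)
Lemma cell_det_expand G w e x (s : 'cV[R]_d) : cell G -> e \in G ->
  (w e *m s) 0 0 = 0 -> (forall f, f \in G -> f != e -> (w f *m s) 0 0 = 1) ->
  (x *m s) 0 0 = 1 ->
  cell_det G w = \sum_(f in G | f != e) cell_det G (upd w f x).
Proof.
move=> cG eG we wf xs; have [en [en_inj Gen rowsE]] := cell_enum cG.
pose W := cell_rows G w.
have updE r : cell_det G (upd w (en r) x) =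
    (x *m \adj W) 0 r / \det (cell_rows G edge_vec).
  rewrite /cell_det; congr (_ / _); rewrite /W !rowsE -det_replace_row.
  congr (\det _); apply/matrixP => a b; rewrite !mxE /upd (inj_eq en_inj).
  by case: eqP.
rewrite big_mkcondr (eq_bigl (fun f => f \in [set en r | r : 'I_d])); last first.
  by move=> f; rewrite -Gen.
rewrite big_imset /=; last by move=> ? ? _ _; apply: en_inj.
have -> : cell_det G w = (x *m \adj W *m (W *m s)) 0 0 /
   \det (cell_rows G edge_vec).
  rewrite mulmxA -(mulmxA x) mul_adj_mx mul_mx_scalar -scalemxAl mxE xs mulr1.
  by [].
rewrite mxE mulr_suml; apply: eq_bigr => r _.
rewrite mulrAC -updE.
have -> : (W *m s) r 0 = (w (en r) *m s) 0 0.
  have -> : (W *m s) r 0 = (row r W *m s) 0 0.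
    by rewrite -row_mul [RHS]mxE.
  by rewrite /W rowsE rowK.
case: eqP => [->|/eqP er]; first by rewrite we mulr0.
by rewrite wf ?mulr1 // Gen imset_f.
Qed.

Lemma cell_det_kernel G w (y : 'cV[R]_d) : cell G -> y != 0 ->
  (forall e, e \in G -> w e *m y = 0) -> cell_det G w = 0.
Proof.
move=> cG y0 hy; have [en [en_inj Gen rowsE]] := cell_enum cG.
rewrite /cell_det (det_mulmx0 _ y0) ?mul0r //.
apply/row_matrixP => r; rewrite row_mul row0 rowsE rowK hy //.
by rewrite Gen imset_f.
Qed.

Lemma cell_det_alternate G w e f : cell G -> e \in G -> f \in G -> e != f ->
  w e = w f -> cell_det G w = 0.
Proof.
move=> cG; have [en [en_inj Gen rowsE]] := cell_enum cG.
rewrite {1}Gen => /imsetP[r _ ->]; rewrite {1}Gen => /imsetP[s _ ->] ers wrs.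
rewrite /cell_det (@determinant_alternate _ _ _ r s) ?mul0r //.
  by apply: contra ers => /eqP ->.
by move=> c; rewrite rowsE !mxE wrs.
Qed.

(** Two cells on opposite sides of a common facet have opposite orientations. The map [1 + phi y],
    with [y] the difference of the two edge vectors, fixes the facet and sends the vector of [e'] to
    that of [e]; its determinant is -1. *)
Lemma cell_det_opposite G G' e e' w w' (phi : 'cV[R]_d) :
  cell G -> cell G' -> e \in G -> e' \in G' -> G :\ e = G' :\ e' ->
  (forall f, f \in G :\ e -> w f = w' f) -> w e = w' e' ->
  (forall f, f \in G :\ e -> (edge_vec f *m phi) 0 0 = 0) ->
  (edge_vec e *m phi) 0 0 = 1 -> (edge_vec e' *m phi) 0 0 = -1 ->
  cell_det G' w' = - cell_det G w.
Proof.
move=> cG cG' eG eG' GG' ww' we phi0 phie phie'.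
have [M hM] := cell_mapP w cG; rewrite (cell_det_map cG hM).
pose y := edge_vec e' - edge_vec e.
have h1 (z : 'rV[R]_d) : z *m (1%:M + phi *m y) = z + (z *m phi) 0 0 *: y.
  by rewrite mulmxDr mulmx1 mulmxA {1}[z *m phi]mx11_scalar mul_scalar_mx.
rewrite (@cell_det_map _ _ ((1%:M + phi *m y) *m M)) //.
  by rewrite det_mulmx det_1D_rank1 dotBl phie phie' addrA subrr sub0r mulN1r.
move=> f fG'; rewrite mulmxA h1.
case: (eqVneq f e') => [->|fe'].
  rewrite phie' scaleN1r /y opprB addrC subrK hM //.
have fG : f \in G :\ e by rewrite GG' !inE fe'.
rewrite phi0 // scale0r addr0 -ww' // hM //.
by move: fG; rewrite inE => /andP[].
Qed.

(** * Triangulated cones: crossing a facet *)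

Section Triangulations.

(** A homogeneous form of a triangulation, as a simplicial fan. The fourth clause is covering; the
    fifth says that a vector lying in two cones has the same coordinates in both, extended by 0, so
    that cones meet in common faces. *)
Definition cone_triangulation (B : {set E}) m (G : 'I_m -> {set E}) : Prop :=
  [/\ injective G, forall k, G k \subset B, forall k, cell (G k),
      forall lam : E -> R, (forall e, e \in B -> 0 <= lam e) ->
        0 < \sum_(e in B) lam e ->
        exists k mu, (forall e, e \in G k -> 0 <= mu e) /\
          \sum_(e in B) lam e *: edge_vec e = \sum_(e in G k) mu e *: edge_vec e
    & forall k l (lam mu : E -> R), (forall e, e \in G k -> 0 <= lam e) ->
        (forall e, e \in G l -> 0 <= mu e) ->
        \sum_(e in G k) lam e *: edge_vec e = \sum_(e in G l) mu e *: edge_vec e ->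
        forall e, (if e \in G k then lam e else 0) =
                  (if e \in G l then mu e else 0)].

Variables (B : {set E}) (m : nat) (G : 'I_m -> {set E}).
Hypothesis triG : cone_triangulation B G.

Let inj_G : injective G. Proof. by case: triG. Qed.
Let G_sub k : G k \subset B. Proof. by case: triG. Qed.
Let G_cell k : cell (G k). Proof. by case: triG. Qed.
Let G_proper := let: And5 _ _ _ _ h := triG in h.
Let G_cover := let: And5 _ _ _ h _ := triG in h.

(** Let [p] be the sum of the facet's edge vectors. For large [K] the vector [K p + e0] lies just
    across the facet, and a cone covering it must contain [p], hence by properness the whole
    facet. *)
Lemma facet_neighbor k f e0 (phi : 'cV[R]_d) :
  f \in G k -> (forall e, e \in G k :\ f -> (edge_vec e *m phi) 0 0 = 0) ->
  e0 \in B -> (edge_vec e0 *m phi) 0 0 < 0 ->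
  exists l f', [/\ f' \in G l, G l :\ f' = G k :\ f &
    (edge_vec f' *m phi) 0 0 < 0].
Proof.
move=> fG phi0 e0B phie0.
have /choice[psi hpsi] l := cell_dual (G_cell l).
pose F := G k :\ f.
have FB : F \subset B by apply: fintype.subset_trans (subD1set _ _) (G_sub k).
pose p := \sum_(e in F) edge_vec e.
pose cp l e := (p *m psi l e) 0 0.
pose cq l e := (edge_vec e0 *m psi l e) 0 0.
(* [K] exceeds every ratio of a coordinate of [e0] to one of [p], so a negative coordinate of [p]
   would keep its sign in [K p + e0]. Ratios with denominator 0 count as 0. *)
pose K := 1 + \sum_l \sum_e `|cq l e| / `|cp l e|.
have K_gt0 : 0 < K.
  rewrite ltr_wpDr ?ltr01 // sumr_ge0 // => l _; rewrite sumr_ge0 // => e _.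
  by rewrite divr_ge0.
have K_big l e : `|cq l e| / `|cp l e| < K.
  rewrite /K ltr_pwDl ?ltr01 // (bigD1 l) //= (bigD1 e) //= -addrA lerDl.
  rewrite addr_ge0 ?sumr_ge0 // => [g _|l' _]; first by rewrite divr_ge0.
  by rewrite sumr_ge0 // => g _; rewrite divr_ge0.
pose lam e := K * (e \in F)%:R + (e == e0)%:R.
have lam_ge0 e : 0 <= lam e by rewrite addr_ge0 // mulr_ge0 // ltW.
have sum_lam : \sum_(e in B) lam e *: edge_vec e = K *: p + edge_vec e0.
  under eq_bigr do rewrite scalerDl; rewrite big_split /=; congr (_ + _).
    rewrite scaler_sumr [LHS](bigID (mem F)) /= [X in _ + X]big1 ?addr0.
      rewrite [LHS](eq_bigl (mem F)) => [|e]; last first.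
        by apply: andb_idl => /(fintype.subsetP FB).
      by apply: eq_bigr => e eF; rewrite [e \in F]eF mulr1.
    by move=> e /andP[_ /negPf ->]; rewrite mulr0 scale0r.
  rewrite (bigD1 e0) //= eqxx scale1r big1 ?addr0 // => e /andP[_ /negPf ->].
  by rewrite scale0r.
have [|l [mu [mu_ge0 muE]]] := G_cover (fun e _ => lam_ge0 e).
  rewrite (bigD1 e0) //= ltr_wpDr ?sumr_ge0 //.
  by rewrite /lam eqxx ltr_wpDl // mulr_ge0 // ltW.
rewrite sum_lam in muE.
have muE' e : e \in G l -> mu e = K * cp l e + cq l e.
  move=> eG; rewrite /cp /cq -dotZl -dotDl muE dot_suml (bigD1 e) //= big1.
    by rewrite addr0 dotZl hpsi // eqxx mulr1.
  by move=> g /andP[gG ge]; rewrite dotZl hpsi // (negPf ge) mulr0.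
have cp_ge0 e : e \in G l -> 0 <= cp l e.
  move=> eG; rewrite leNgt; apply/negP => cp_lt0.
  have := mu_ge0 e eG; rewrite muE' // leNgt => /negP; apply.
  have := K_big l e; rewrite ltr_pdivrMr ?normr_gt0 ?lt_eqF // => hK.
  rewrite (le_lt_trans (y := K * cp l e + `|cq l e|)) ?lerD2l ?ler_norm //.
  by rewrite -[_ * cp l e]opprK -mulrN -(ltr0_norm cp_lt0) addrC subr_lt0.
have pE : \sum_(e in G k) (e \in F)%:R *: edge_vec e =
   \sum_(e in G l) cp l e *: edge_vec e.
  rewrite -(cell_coord p (G_cell l) (hpsi l)) /p.
  rewrite (bigD1 f) //= !inE eqxx scale0r add0r; apply: eq_big => e.
    by rewrite !inE andbC.
  by move=> /andP[eG ef]; rewrite !inE eG ef scale1r.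
have cp_eq := G_proper (fun e _ => ler0n R (e \in F)) cp_ge0 pE.
have Fl : F \subset G l.
  apply/fintype.subsetP => e eF; have := cp_eq e; rewrite eF.
  have -> : e \in G k by move: eF; rewrite inE => /andP[].
  by case: (e \in G l) => // /eqP; rewrite oner_eq0.
have /cards1P[f' Ff'] : #|G l :\: F| == 1%N.
  have := cardsD1 f (G k); rewrite fG -/F => dF.
  have := cardsID F (G l); rewrite (finset.setIidPr Fl) (G_cell l).1.
  rewrite -(G_cell k).1 dF addnC => /addIn ->.
  by [].
have f'l : f' \in G l by have := set11 f'; rewrite -Ff' inE => /andP[].
have lE : G l :\ f' = F.
  by rewrite -Ff' finset.setDDr finset.setDv finset.set0U (finset.setIidPr Fl).
exists l, f'; split => //.
have : ((K *: p + edge_vec e0) *m phi) 0 0 < 0.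
  rewrite dotDl dotZl /p dot_suml big1 ?mulr0 ?add0r //.
rewrite muE dot_suml (bigD1 f') //= big1 => [|e /andP[eG ef']]; last first.
  by rewrite dotZl phi0 ?mulr0 // -/F -lE !inE ef'.
rewrite addr0 dotZl => h.
by have := mu_ge0 f' f'l; rewrite le0r => /orP[/eqP f0|/pmulr_rlt0 <- //];
  move: h; rewrite f0 mul0r ltxx.
Qed.

(** If [f] and [f'] lie on the same side of the common facet, then the vector of [f'] plus a large
    multiple of the facet sum lies in both cones. Its coordinate 1 at [f'] forces [f'] into [G k],
    whence [f' = f]. *)
Lemma facet_side_uniq k l f f' (phi : 'cV[R]_d) :
  f \in G k -> f' \in G l -> G k :\ f = G l :\ f' ->
  (forall e, e \in G k :\ f -> (edge_vec e *m phi) 0 0 = 0) ->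
  0 < (edge_vec f *m phi) 0 0 * (edge_vec f' *m phi) 0 0 ->
  k = l /\ f = f'.
Proof.
move=> fG f'G eF phi0 sgn.
have [psi hpsi] := cell_dual (G_cell k).
pose c e := (edge_vec f' *m psi e) 0 0.
have f'E : edge_vec f' = \sum_(e in G k) c e *: edge_vec e.
  exact: cell_coord (G_cell k) hpsi.
have cf : (edge_vec f' *m phi) 0 0 = c f * (edge_vec f *m phi) 0 0.
  rewrite {1}f'E dot_suml (bigD1 f) //= big1 ?addr0 ?dotZl // => e /andP[eG ef].
  by rewrite dotZl phi0 ?mulr0 // !inE ef.
have cf_gt0 : 0 < c f.
  have := sgn; rewrite cf mulrCA pmulr_lgt0 //.
  by rewrite -expr2 lt0r sqr_ge0 andbT sqrf_eq0; apply: contraTneq sgn => ->;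
    rewrite mul0r ltxx.
pose K := \sum_(e in G k) `|c e|.
have K_ge e : e \in G k -> 0 <= K + c e.
  move=> eG; rewrite -lerBlDr sub0r (le_trans (y := `|c e|)) //.
    by rewrite -normrN ler_norm.
  by rewrite /K (bigD1 e) //= lerDl sumr_ge0.
have K_ge0 : 0 <= K by rewrite sumr_ge0.
have f'F : f' \notin G k :\ f by rewrite eF !inE eqxx.
have fF : f \notin G k :\ f by rewrite !inE eqxx.
have sumE : \sum_(e in G l) (if e == f' then 1 else K) *: edge_vec e =
    \sum_(e in G k) (if e == f then c f else K + c e) *: edge_vec e.
  rewrite (bigD1 f') //= eqxx scale1r {1}f'E.
  rewrite [in RHS](bigD1 f) //= eqxx (bigD1 f) //= -addrA; congr (_ + _).
  rewrite [X in _ + X](eq_bigl (fun e => (e \in G k) && (e != f))); last first.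
    by move=> e; have := congr1 (fun A : {set E} => e \in A) eF;
      rewrite !inE andbC => ->; rewrite andbC.
  rewrite -big_split /=; apply: eq_bigr => e /andP[eG ef] /=.
  rewrite (negPf ef) [e == f'](_ : _ = false) -?scalerDl 1?addrC //.
  by apply/negP => /eqP e'; move: f'F; rewrite !inE -e' ef eG.
have := @G_proper l k _ _ _ _ sumE f'; rewrite f'G eqxx => h.
have f'k : f' \in G k.
  move: h; case: (f' \in G k) => // h; suff /eqP : (1 : R) = 0 by rewrite oner_eq0.
  by apply: h => e eG; case: ifP => // _; [exact: ltW | exact: K_ge].
have ff' : f' = f.
  by apply/eqP; apply: contraNT f'F => f'f; rewrite !inE f'f.
split=> //; apply: inj_G.
by rewrite -(finset.setD1K fG) -(finset.setD1K f'G) eF ff'.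
Qed.

End Triangulations.

(** * Edge labels and the determinant that detects distinct labels *)

Implicit Types (a : 'I_n -> nat) (b : 'I_N -> nat).

Definition potential (f : V -> R) : 'cV[R]_d :=
  \col_c (f (enum_val c) - f (inl last)).

Lemma edge_potential f (e : E) :
  (edge_vec e *m potential f) 0 0 = f (inr e.2) - f (inl e.1).
Proof. by rewrite dotBl !vtx_mul opprB addrA subrK. Qed.

(* The endpoint of smaller height, the root being the highest vertex *)
Definition label a b (e : E) : V :=
  if (e.1 == last) || (a e.2 < b e.1)%N then inr e.2 else inl e.1.

(** With this sign, the label vector of an edge is its edge vector restricted to the coordinate of
    its label. *)
Definition label_vec (v : V) : 'rV[R]_d :=
  if v is inl _ then - vtx v else vtx v.

Definition rainbow a b (G : {set E}) : bool :=
  #|[set label a b e | e in G]| == #|G|.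

Lemma label_nonroot a b e : label a b e \in nonroot.
Proof.
rewrite /label; case: ifP => [|/norP[e1 _]]; rewrite !inE //.
Qed.

(** All labels lie among the [d] nonroot vertices, so [d] distinct ones exhaust them. *)
Lemma rainbow_label a b (G : {set E}) v : #|G| = d -> rainbow a b G ->
  v \in nonroot -> exists2 e, e \in G & label a b e = v.
Proof.
move=> cG /eqP rG vn; suff : v \in [set label a b e | e in G].
  by case/imsetP => e eG ->; exists e.
suff -> : [set label a b e | e in G] = nonroot by [].
apply/eqP; rewrite eqEcard rG cG leqnn andbT.
by apply/fintype.subsetP => _ /imsetP[e _ ->]; apply: label_nonroot.
Qed.

(** Doubling makes room for breaking ties: if [a j = b i], then [j] is above [i], in agreement with
    [label] for [i] other than the root. *)
Definition height a b (v : V) : nat :=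
  match v with inl i => (b i).*2 | inr j => (a j).*2.+1 end.

(** A repeated label gives two equal rows. Otherwise, with the edges indexed by their labels, the
    edge vectors form a matrix triangular for the height, with the same diagonal as the diagonal
    matrix of label vectors, so the quotient is 1. *)
Lemma cell_det_label a b (G : {set E}) : cell G ->
  cell_det G (label_vec \o label a b) = (rainbow a b G)%:R.
Proof.
move=> cG; case: (boolP (rainbow a b G)) => rG; last first.
  case: (boolP [exists e in G, [exists f in G,
      (e != f) && (label a b e == label a b f)]]) =>
      [/exists_inP[e eG /exists_inP[f fG /andP[ef /eqP lef]]]|no].
    by apply: (cell_det_alternate cG eG fG ef); rewrite /= lef.
  case/negP: rG; apply/imset_injP => e f eG fG lef.
  apply/eqP; apply: contraNT no => ef; apply/exists_inP; exists e => //.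
  by apply/exists_inP; exists f => //; rewrite ef lef /=.
have h (c : 'I_d) : exists e, e \in G /\ label a b e = enum_val c.
  have cn : (enum_val c : V) \in nonroot by apply: enum_valP.
  by have [e eG <-] := rainbow_label cG.1 rG cn; exists e.
have [lb hlb] := choice h.
have [M hM] := cell_mapP (label_vec \o label a b) cG.
rewrite (cell_det_map cG hM).
pose B' := \matrix_(c < d) edge_vec (lb c).
pose W' := \matrix_(c < d) label_vec (enum_val c).
have BM : B' *m M = W'.
  apply/row_matrixP => c; have [lG lE] := hlb c.
  by rewrite row_mul !rowK hM //= lE.
have neq_ev (c c' : 'I_d) : c != c' -> (enum_val c == enum_val c' :> V) = false.
  by move=> /negPf cc'; rewrite (inj_eq enum_val_inj).
have detW : \det W' = \prod_c W' c c.
  (* With constant height the condition says that all off-diagonal entries vanish. *)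
  apply: (@det_height_triangular _ _ (fun=> 0%N)) => r c rc.
  rewrite !mxE /label_vec; case E1 : (enum_val r) => [i|j];
    by rewrite !mxE -E1 neq_ev // ?oppr0 eqxx.
have BE c c' : B' c c' = (inr (lb c).2 == enum_val c' :> V)%:R -
    (inl (lb c).1 == enum_val c' :> V)%:R.
  by rewrite !mxE.
have Bdiag c : B' c c = W' c c.
  rewrite BE mxE; have [_] := hlb c; rewrite /label.
  by case: ifP => _ Ec; rewrite -Ec /= !mxE -Ec !eqxx ?subr0 ?sub0r.
have detB : \det B' = \prod_c B' c c.
  apply: (@det_height_triangular _ _ (fun c => height a b (enum_val c))) => r c rc.
  rewrite BE; have := neq_ev _ _ rc; have [_] := hlb r; rewrite /label.
  case: ifP => [lab|/norP[_]] => [Er|/[swap] Er]; rewrite -Er.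
    move=> ->.
    rewrite sub0r oppr_eq0 pnatr_eq0 eqb0 negbK => /eqP Ec.
    move: lab; case/orP => [/eqP i_last|].
      by have := enum_valP c; rewrite -Ec i_last !inE eqxx.
    by rewrite -Ec /= -doubleS leq_double.
  rewrite -leqNgt => le_ba ->.
  rewrite subr0 pnatr_eq0 eqb0 negbK => /eqP <- /=.
  by rewrite ltnS leq_double.
have nzW : \det W' != 0.
  rewrite detW; apply/prodf_neq0 => c _; rewrite mxE /label_vec.
  by case Ec : (enum_val c) => [i|j]; rewrite !mxE -Ec eqxx ?oppr_eq0 oner_eq0.
have := congr1 determinant BM; rewrite det_mulmx detB.
rewrite (eq_bigr (fun c => W' c c)) // -detW => /(congr1 (fun x => x / \det W')).
by rewrite mulrAC mulfV // mul1r.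
Qed.

(** * The Sperner argument: invariance under moving one vertex *)

Section Sperner.

Variables (T : 'I_N -> {set 'I_n}) (m : nat) (G : 'I_m -> {set E}).
Hypothesis Tlast : T last = [set: 'I_n].
Hypothesis triG : cone_triangulation (incidences T) G.

Let inj_G : injective G. Proof. by case: triG. Qed.
Let G_sub k : G k \subset incidences T. Proof. by case: triG. Qed.
Let G_cell k : cell (G k). Proof. by case: triG. Qed.
Let G_proper := let: And5 _ _ _ _ h := triG in h.
Let G_cover := let: And5 _ _ _ h _ := triG in h.

(** The sum of coordinates in the basis of label vectors of nonroot vertices. *)
Definition label_sum : 'cV[R]_d := potential (fun v =>
  match v with inl i => if i == last then 0 else -1 | inr _ => 1 end).

Lemma label_vec_sum v : v \in nonroot -> (label_vec v *m label_sum) 0 0 = 1.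
Proof.
case: v => [i|j] vn /=; last by rewrite vtx_mul eqxx subr0.
rewrite -sub0r dotBl mul0mx mxE sub0r vtx_mul eqxx subr0 ifN ?opprK //.
by apply: contraTneq vn => ->; rewrite !inE eqxx.
Qed.

Section Facet.
Variables (a : 'I_n -> nat) (b : 'I_N -> nat) (i : 'I_N) (j : 'I_n).
Hypotheses (il : i != last) (ajb : (a j < b i)%N).
Let e : E := (i, j).
Let w := label_vec \o label a b.
Let x := label_vec (inl i).
(** The change in the label vector of [e] when [i] moves down past [j]; its coordinate sum is 0. *)
Let delta := x - label_vec (inr j).
(** The row of [f] is overwritten, so up to orientation this depends only on the facet opposite
    [f]. *)
Let facet_det k f := cell_det (G k) (upd (upd w e delta) f x).

(** The rows at [e] and [f] involve only the label vectors of [i] and [j]. If no other edge has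
    label [v], the coordinate functional at [v] kills every row. *)
Lemma facet_labels k f v : facet_det k f != 0 -> v \in nonroot ->
  v != inl i -> v != inr j ->
  exists2 g, (g \in G k) && (g != f) & label a b g = v.
Proof.
move=> nz vn vi vj.
suff /exists_inP[g gG /andP[gf /eqP gv]] :
    [exists g in G k, (g != f) && (label a b g == v)].
  by exists g; rewrite // gG.
apply: contraNT nz => /exists_inPn no; apply/eqP.
have vl : (inl last == v) = false by move: vn; rewrite !inE eq_sym => /negPf.
pose y := potential (fun u => (u == v)%:R).
have yE u : (vtx u *m y) 0 0 = (u == v)%:R by rewrite vtx_mul vl subr0.
have lyE u : (label_vec u *m y) 0 0 = (if u is inl _ then - (u == v)%:R else (u == v)%:R).
  by case: u => u /=; rewrite -?yE // -sub0r dotBl mul0mx mxE sub0r.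
rewrite /facet_det (cell_det_kernel (y := y)) //.
  apply/negP => /eqP y0; have := yE v; rewrite y0 mulmx0 mxE eqxx => /eqP.
  by rewrite eq_sym oner_eq0.
move=> g gG; apply/rowP => z; rewrite ord1 [RHS]mxE /upd.
have x0 : (x *m y) 0 0 = 0 by rewrite lyE /= eq_sym (negPf vi) oppr0.
case: eqP => [_ //|/eqP gf]; case: eqP => [_|_].
  by rewrite /delta dotBl x0 lyE /= eq_sym (negPf vj) subr0.
have := no g gG; rewrite gf /= => /negPf lg.
by rewrite lyE lg oppr0; case: (label a b g).
Qed.

(** [P] is constant on the two components left by deleting [f]. A vertex other than the root, [i]
    and [j] labels a remaining edge, whose other end is the root or higher; climbing along such
    edges ends at the root or at [i], since [j] is joined to [i] by [e]. *)
Lemma facet_potential k f (P : V -> R) : facet_det k f != 0 ->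
  e \in G k -> f != e ->
  (forall g, g \in G k :\ f -> P (inr g.2) = P (inl g.1)) ->
  P (inl last) = 0 ->
  forall v, P v = 0 \/
    P v = P (inl i) /\ (height a b v <= height a b (inl i))%N.
Proof.
move=> nz eG fe Peq Pl v.
pose M := (\max_(u : V) height a b u)%N.
have [p hp] := ubnP (M - height a b v)%N.
elim: p => // p IHp in v hp *.
have hM u : (height a b u <= M)%N by apply: leq_bigmax.
have step u : P v = P u -> (height a b v < height a b u)%N -> P v = 0 \/
    P v = P (inl i) /\ (height a b v <= height a b (inl i))%N.
  move=> vu lt_vu; rewrite vu; have [||[-> hu]] := IHp u; [|by left|right].
    by rewrite (leq_trans _ (ltnSE hp)) // ltn_sub2l // (leq_trans lt_vu).
  by split => //; rewrite (leq_trans (ltnW lt_vu)).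
case: (eqVneq v (inl last)) => [->|vl]; first by left.
case: (eqVneq v (inl i)) => [->|vi]; first by right.
case: (eqVneq v (inr j)) => [vj|vj].
  rewrite vj; right; split; last by move: ajb => /=; lia.
  by apply: (Peq e); rewrite !inE eq_sym fe.
have vn : v \in nonroot by rewrite !inE.
have [g /andP[gG gf] gv] := facet_labels nz vn vi vj.
have Pg : P (inr g.2) = P (inl g.1) by apply: Peq; rewrite !inE gf.
move: gv; rewrite /label; case: ifP => [/orP[/eqP gl|lt_ab]|/norP[_ le_ba]] vE.
- by left; rewrite -vE Pg gl.
- by apply: (step (inl g.1)); rewrite -vE //= -doubleS leq_double.
- by apply: (step (inr g.2)); rewrite -vE //= ltnS leq_double leqNgt.
Qed.

Hypothesis Ti : exists2 j', j' \in T i & (b i <= a j')%N.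

(** A facet with a nonzero term is interior. Its normal functional takes only the values 0, 1, -1 on
    edges, so the two adjacent cells have opposite terms, and no third cell has this facet. *)
Lemma facet_det_fiber (F : {set E}) : e \in F ->
  \sum_(p : 'I_m * E | [&& p.2 \in G p.1, p.2 != e & G p.1 :\ p.2 == F])
     facet_det p.1 p.2 = 0.
Proof.
move=> eF; pose Q (p : 'I_m * E) := [&& p.2 \in G p.1, p.2 != e & G p.1 :\ p.2 == F].
change (\sum_(p | Q p) facet_det p.1 p.2 = 0).
case: (boolP [exists p, Q p && (facet_det p.1 p.2 != 0)]); last first.
  rewrite negb_exists => /forallP no; apply: big1 => p Qp.
  by have := no p; rewrite Qp negbK => /eqP.
case/existsP => -[k f] /andP[/and3P[/= fG fe /eqP GF] nz].
have eG : e \in G k by move: eF; rewrite -GF inE => /andP[].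
have [psi hpsi] := cell_dual (G_cell k).
pose P v := (vtx v *m psi f) 0 0.
have eP g : (edge_vec g *m psi f) 0 0 = P (inr g.2) - P (inl g.1).
  by rewrite dotBl.
have phi0 g : g \in G k :\ f -> (edge_vec g *m psi f) 0 0 = 0.
  by rewrite !inE => /andP[/negPf gf gG]; rewrite hpsi // gf.
have phif : (edge_vec f *m psi f) 0 0 = 1 by rewrite hpsi ?eqxx.
have Pl : P (inl last) = 0 by rewrite /P vtx_root mul0mx mxE.
have Peq g : g \in G k :\ f -> P (inr g.2) = P (inl g.1).
  by move=> gF; apply/eqP; rewrite -subr_eq0 -eP phi0.
have P2 := facet_potential nz eG fe Peq Pl.
have P2' v : P v = 0 \/ P v = P (inl i) by case: (P2 v) => [|[]]; [left|right].
have q1 : P (inl i) = 1 \/ P (inl i) = -1.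
  move: phif; rewrite eP; case: (P2' (inr f.2)) => ->; case: (P2' (inl f.1)) => ->.
  - by rewrite subrr => /eqP; rewrite eq_sym oner_eq0.
  - by rewrite sub0r => <-; right; rewrite opprK.
  - by rewrite subr0; left.
  - by rewrite subrr => /eqP; rewrite eq_sym oner_eq0.
have neg g : (edge_vec g *m psi f) 0 0 < 0 -> (edge_vec g *m psi f) 0 0 = -1.
  rewrite eP; case: (P2' (inr g.2)) => ->; case: (P2' (inl g.1)) => ->;
    case: q1 => q1; rewrite ?subrr ?sub0r ?subr0 ?q1 ?opprK ?ltxx ?ltr10 //.
(* An edge of the polytope strictly across the facet. If [P] is 1 at [i], take [(i, j')] with [j']
   above [i], where [P] must be 0; if [P] is -1 at [i], hence at [j], take the edge from the root to
   [j]. *)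
have [e0 e0B e0P] : exists2 e0, e0 \in incidences T &
    (edge_vec e0 *m psi f) 0 0 < 0.
  case: q1 => q1.
    have [j' j'T le_ba] := Ti; exists (i, j'); first by rewrite inE.
    rewrite eP /= q1; case: (P2 (inr j')) => [->|[_ /= h]].
      by rewrite sub0r oppr_lt0 ltr01.
    by exfalso; lia.
  exists (last, j); first by rewrite inE /= Tlast inE.
  rewrite eP /= Pl subr0 (Peq e) /= ?q1 ?oppr_lt0 ?ltr01 //.
  by rewrite !inE eq_sym fe.
have [l [f' [f'G GF' /neg f'P]]] := facet_neighbor triG fG phi0 e0B e0P.
have f'e : f' != e.
  by apply: contraTneq eF => <-; rewrite -GF -GF' !inE eqxx.
have opp : facet_det l f' = - facet_det k f.
  apply: (cell_det_opposite (phi := psi f) (G_cell k) (G_cell l) fG f'G) => //.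
    move=> g gF; rewrite /upd.
    have -> : g == f = false by move: gF; rewrite !inE => /andP[/negPf].
    have -> : g == f' = false by move: gF; rewrite -GF' !inE => /andP[/negPf].
    by [].
  by rewrite /upd !eqxx.
have lf_kf : (l, f') != (k, f).
  apply/eqP => -[_ ff]; move: f'P; rewrite ff phif => /eqP.
  by rewrite -subr_eq0 opprK -(natrD _ 1 1) pnatr_eq0.
have Qkf : Q (k, f) by rewrite /Q /= fG fe GF eqxx.
have Qlf : Q (l, f') by rewrite /Q /= f'G f'e GF' GF eqxx.
rewrite (bigD1 (k, f)) //= (bigD1 (l, f')) /=; last by rewrite Qlf.
rewrite opp big1 ?addr0 ?subrr // => -[k1 f1] /andP[/andP[Q1 ne1] ne2].
have [/= f1G f1e /eqP G1F] := and3P Q1.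
have f1P : (edge_vec f1 *m psi f) 0 0 != 0.
  apply/eqP => f10; have psi0 : psi f = 0.
    apply: (cell_kernel (G_cell k1)) => g gG.
    case: (eqVneq g f1) => [-> //|gf1]; apply: phi0.
    by rewrite GF -G1F !inE gf1.
  by move/eqP: phif; rewrite psi0 mulmx0 mxE eq_sym oner_eq0.
(* A third cell would lie on the same side as one of the first two. *)
exfalso; move: f1P; rewrite neq_lt => /orP[lt0|gt0].
  have [|||] := @facet_side_uniq _ _ _ triG l k1 f' f1 (psi f) f'G f1G.
  - by rewrite GF' GF.
  - by rewrite GF'.
  - by rewrite f'P mulN1r oppr_gt0.
  - by move=> lk ff; case/eqP: ne2; rewrite lk ff.
have [|||] := @facet_side_uniq _ _ _ triG k k1 f f1 (psi f) fG f1G => //.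
- by rewrite GF.
- by rewrite phif mul1r.
- by move=> lk ff; case/eqP: ne1; rewrite lk ff.
Qed.

(** Since [delta] has coordinate sum 0, each determinant expands over the facets containing [e];
    regrouping the terms by facet makes them cancel. *)
Lemma sum_det_flip :
  \sum_(k | e \in G k) cell_det (G k) (upd w e delta) = 0.
Proof.
have expand k : e \in G k -> cell_det (G k) (upd w e delta) =
    \sum_(f in G k | f != e) facet_det k f.
  move=> eG; apply: (cell_det_expand (s := label_sum) (G_cell k) eG).
  - by rewrite /upd eqxx dotBl !label_vec_sum ?subrr // !inE.
  - by move=> f fG fe; rewrite /upd (negPf fe) label_vec_sum // label_nonroot.
  - by rewrite label_vec_sum // !inE.
rewrite (eq_bigr _ expand) pair_big_dep /=.
rewrite (partition_big (fun p : 'I_m * E => G p.1 :\ p.2)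
   (fun F : {set E} => e \in F)) /= => [|p /and3P[eG _ pe]]; last first.
  by rewrite !inE eq_sym pe.
apply: big1 => F eF; rewrite -[RHS](facet_det_fiber eF); apply: eq_bigl => p.
case: (eqVneq (G p.1 :\ p.2) F) => [GF|_]; rewrite ?andbF ?andbT //.
by have -> : e \in G p.1 by move: eF; rewrite -GF inE => /andP[].
Qed.

End Facet.

(** Lowering [b i] by one changes a label only if some [j] has height [b' i]. As [a] is injective
    there is at most one such [j], and only the edge [(i, j)] is relabelled. *)
Lemma sum_det_step a b b' i : injective a -> i != last ->
  (forall i', i' != i -> b' i' = b i') -> b i = (b' i).+1 ->
  (exists2 j', j' \in T i & (b i <= a j')%N) ->
  \sum_k cell_det (G k) (label_vec \o label a b') =
  \sum_k cell_det (G k) (label_vec \o label a b).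
Proof.
move=> inj_a il bb' bi Ti.
case: (boolP [exists j, a j == b' i]) => [/existsP[j /eqP aj]|/existsPn no].
  have ajb : (a j < b i)%N by rewrite aj bi.
  have := sum_det_flip il ajb Ti; set e := (i, j); set w := label_vec \o label a b.
  set delta := _ - _ => flip; apply/eqP; rewrite -subr_eq0 -sumrB.
  rewrite (bigID (fun k => e \in G k)) /=.
  apply/eqP; rewrite -[RHS]addr0; congr (_ + _); last first.
    apply: big1 => k eG; apply/eqP; rewrite subr_eq0; apply/eqP.
    apply: eq_cell_det => // g gG /=; congr label_vec; rewrite /label.
    case: (eqVneq g.1 i) => [gi|gi]; last by rewrite bb'.
    have : a g.2 != b' i.
      apply: contraNneq eG => ag; have <- : g = e => //.
      by rewrite /e -gi -(inj_a g.2 j) ?ag //; case: (g).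
    rewrite gi bi => ne; congr (if _ || _ then _ else _).
    by rewrite ltnS [(a g.2 <= _)%N]leq_eqVlt (negPf ne).
  rewrite -[RHS]flip; apply: eq_bigr => k eG; rewrite -cell_det_updB //; congr (_ - _).
    apply: eq_cell_det => // g gG; rewrite /upd /w /= /label.
    case: (eqVneq g e) => [->|ge]; first by rewrite /e /= (negPf il) aj ltnn.
    congr label_vec; case: (eqVneq g.1 i) => [gi|gi]; last by rewrite bb'.
    have : a g.2 != b' i.
      apply: contraNneq ge => ag; apply/eqP.
      by rewrite /e -gi -(inj_a g.2 j) ?ag //; case: (g).
    rewrite gi bi => ne; congr (if _ || _ then _ else _).
    by rewrite ltnS [(a g.2 <= _)%N]leq_eqVlt (negPf ne).
  apply: eq_cell_det => // g gG; rewrite /upd /w /= /label.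
  by case: (eqVneq g e) => [->|//]; rewrite /e /= ajb orbT.
apply: eq_bigr => k _; apply: eq_cell_det => // g gG /=; congr label_vec.
rewrite /label; case: (eqVneq g.1 i) => [gi|gi]; last by rewrite bb'.
by rewrite gi bi ltnS [(a g.2 <= _)%N]leq_eqVlt (negPf (no g.2)).
Qed.

(** * The base labelling, with all nonroot unbarred vertices at the bottom *)

Hypothesis T_neq0 : forall i, exists j, j \in T i.
Hypothesis G_neq0 : forall k i, exists j, (i, j) \in G k.

Lemma base_rainbow a b k : (forall i, i != last -> b i = 0%N) ->
  (forall j, (last, j) \in G k) -> rainbow a b (G k).
Proof.
move=> b0 lastG; rewrite /rainbow (G_cell k).1; apply/eqP; congr #|pred_of_set _|.
apply/eqP; rewrite finset.eqEsubset; apply/andP; split.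
  by apply/fintype.subsetP => _ /imsetP[e _ ->]; apply: label_nonroot.
apply/fintype.subsetP => -[i|j] vn; last first.
  by apply/imsetP; exists (last, j); rewrite // /label eqxx.
have il : i != last by apply: contraTneq vn => ->; rewrite !inE eqxx.
have [j ijG] := G_neq0 k i; apply/imsetP; exists (i, j) => //.
by rewrite /label /= (negPf il) b0.
Qed.

(** At height 0 every edge away from the root is labelled by its unbarred end, so a barred label can
    come only from a root edge. *)
Lemma base_lastG a b k : (forall i, i != last -> b i = 0%N) ->
  rainbow a b (G k) -> forall j, (last, j) \in G k.
Proof.
move=> b0 rG j; have jn : inr j \in nonroot by rewrite !inE.
have [[i j'] eG] := rainbow_label (G_cell k).1 rG jn.
rewrite /label /=; case: (eqVneq i last) => [il [<-]|il]; first by rewrite -il.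
by rewrite b0.
Qed.

Lemma big_set_if (A : {set E}) (M : nmodType) (F : E -> M) :
  \sum_(e in A) F e = \sum_i \sum_j (if (i, j) \in A then F (i, j) else 0).
Proof. by rewrite pair_big /= big_mkcond; apply: eq_bigr => -[]. Qed.

(** The margins of a coefficient matrix are, up to sign, coordinates of the vector it represents, so
    they agree for any two representations. *)
Lemma col_margin (A : {set E}) (F : E -> R) j :
  ((\sum_(e in A) F e *: edge_vec e) *m
    potential (fun v => (v == inr j)%:R)) 0 0 =
  \sum_i (if (i, j) \in A then F (i, j) else 0).
Proof.
rewrite dot_suml big_set_if; apply: eq_bigr => i _.
rewrite (bigD1 j) //= big1 ?addr0 => [|j' j'j].
  by case: ifP => // _; rewrite dotZl edge_potential eqxx subr0 mulr1.
case: ifP => // _; rewrite dotZl edge_potential /= subr0.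
by rewrite [_ == _](negPf j'j) mulr0.
Qed.

Lemma row_margin (A : {set E}) (F : E -> R) i : i != last ->
  ((\sum_(e in A) F e *: edge_vec e) *m
    potential (fun v => (v == inl i)%:R)) 0 0 =
  - \sum_j (if (i, j) \in A then F (i, j) else 0).
Proof.
move=> il; rewrite dot_suml big_set_if (bigD1 i) //= [X in _ + X]big1 ?addr0.
  rewrite -sumrN; apply: eq_bigr => j _; case: ifP => _; last by rewrite oppr0.
  by rewrite dotZl edge_potential eqxx /= sub0r mulrN1.
move=> i' i'i; rewrite big1 // => j _; case: ifP => // _.
by rewrite dotZl edge_potential /= [_ == _](negPf i'i) subrr mulr0.
Qed.

(** Put weight [N] on every root edge and weight 1 on one edge at each other [i]. In a cone covering
    this vector, column [j] must sum to at least [N], while the [N - 1] other rows supply at most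
    [N - 1], so the root edge to [j] is present. *)
Lemma base_exists : exists k, forall j, (last, j) \in G k.
Proof.
have [t tT] := choice T_neq0.
pose lam (e : E) : R := if e.1 == last then N%:R else (e.2 == t e.1)%:R.
have lam_ge0 e : 0 <= lam e by rewrite /lam; case: ifP.
have N_gt0 : (0 < N)%N by case: (last) => i; apply: leq_ltn_trans.
have inB i : (i, t i) \in incidences T by rewrite inE; apply: tT.
have [|k [mu [mu_ge0 muE]]] := G_cover (fun e _ => lam_ge0 e).
  rewrite (bigD1 (last, t last)) //= ltr_wpDr ?sumr_ge0 //.
  by rewrite /lam eqxx ltr0n.
exists k => j; apply/negP => /negP lastG.
have muR i : i != last ->
    \sum_j (if (i, j) \in G k then mu (i, j) else 0) = 1.
  move=> il; apply: oppr_inj; rewrite -row_margin // -muE row_margin //.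
  congr (- _); rewrite (bigD1 (t i)) //= inB /lam /= (negPf il) eqxx.
  by rewrite big1 ?addr0 // => j' /negPf j't; rewrite j't if_same.
have := col_margin (incidences T) lam j.
rewrite muE col_margin (bigD1 last) //= (negPf lastG) add0r.
rewrite [in RHS](bigD1 last) //= inE /= Tlast inE {1}/lam /= eqxx => h.
have : (N%:R : R) <= \sum_(i < N | i != last) 1.
  rewrite (le_trans (y := \sum_(i < N | i != last)
     (if (i, j) \in G k then mu (i, j) else 0))) //.
    by rewrite h lerDl sumr_ge0 // => i _; case: ifP.
  apply: ler_sum => i il; rewrite -[leRHS](muR i il) (bigD1 j) //= lerDl.
  by rewrite sumr_ge0 // => j' _; case: ifP => // /mu_ge0.
rewrite big_const iter_addr_0 -/(_%:R) ler_nat leqNgt => /negP; apply.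
rewrite (eq_card (B := predC1 last)) // cardC1 card_ord.
by case: (N) N_gt0.
Qed.

(** The right-hand side does not depend on [t], so this vector lies in the cone of every cell
    containing all root edges; properness then compares the choices [t] of two such cells. *)
Lemma base_sum k (t : 'I_N -> 'I_n) : (forall j, (last, j) \in G k) ->
  (forall i, (i, t i) \in G k) ->
  \sum_(e in G k) (if e.1 == last
      then N%:R - \sum_(i < N | i != last) (t i == e.2)%:R
      else (e.2 == t e.1)%:R) *: edge_vec e =
  \sum_j N%:R *: vtx (inr j) - \sum_(i < N | i != last) vtx (inl i).
Proof.
move=> lastG tG; rewrite big_set_if (bigD1 last) //= eqxx.
rewrite (eq_bigr (fun j => N%:R *: vtx (inr j) -
    \sum_(i < N | i != last) (t i == j)%:R *: vtx (inr j))); last first.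
  move=> j _; rewrite lastG /edge_vec vtx_root subr0 scalerBl.
  by rewrite scaler_suml.
rewrite sumrB -addrA; congr (_ + _).
rewrite exchange_big -!sumrN -big_split; apply: eq_bigr => i il /=.
rewrite (bigD1 (t i)) //= eqxx scale1r big1 ?addr0; last first.
  by move=> j /negPf jt; rewrite eq_sym jt scale0r.
rewrite (bigD1 (t i)) //= tG (negPf il) eqxx scale1r big1 ?addr0; last first.
  by move=> j /negPf jt; rewrite jt scale0r if_same.
by rewrite /edge_vec /= addKr.
Qed.

Lemma base_uniq a b k l : (forall i, i != last -> b i = 0%N) ->
  rainbow a b (G k) -> rainbow a b (G l) -> k = l.
Proof.
move=> b0 rk rl.
have lk := base_lastG b0 rk; have ll := base_lastG b0 rl.
have [t tG] := choice (G_neq0 k); have [u uG] := choice (G_neq0 l).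
have sums := etrans (base_sum lk tG) (esym (base_sum ll uG)).
have coef_ge0 (v : 'I_N -> 'I_n) (e : E) : 0 <= (if e.1 == last
      then N%:R - \sum_(i < N | i != last) (v i == e.2)%:R
      else (e.2 == v e.1)%:R) :> R.
  case: ifP => // _; rewrite subr_ge0 -natr_sum ler_nat.
  rewrite (leq_trans (n := (\sum_(i < N) 1)%N)) //; last by rewrite sum1_card card_ord.
  by rewrite [leqLHS]big_mkcond /=; apply: leq_sum => i _; case: ifP => // _; case: eqP.
have eq_lam := G_proper (fun e _ => coef_ge0 t e) (fun e _ => coef_ge0 u e) sums.
have tu i : i != last -> t i = u i.
  move=> il; have := eq_lam (i, t i); rewrite tG /= (negPf il) eqxx.
  by case: ifP => _; [case: eqP => // _|] => /eqP; rewrite oner_eq0.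
apply: inj_G; apply/eqP; rewrite eqEcard (G_cell k).1 (G_cell l).1 leqnn andbT.
apply/fintype.subsetP => -[i j] eG; case: (eqVneq i last) => [-> //|il].
have /imset_injP inj_l := rk.
have := inj_l _ _ eG (tG i); rewrite /label /= (negPf il) b0 //=.
by move=> /(_ erefl) [->]; rewrite tu.
Qed.

(** Written as a sum of determinants, the count is unchanged when one positive [b i] drops by one,
    which also preserves the hypothesis; at heights 0 exactly one cell counts. *)
Theorem rainbow_cell_uniq a b : injective a ->
  (forall i, i != last -> exists2 j, j \in T i & (b i <= a j)%N) ->
  \sum_k (rainbow a b (G k))%:R = 1 :> R.
Proof.
move=> inj_a.
have [p hp] := ubnP (\sum_(i < N | i != last) b i)%N.
elim: p => // p IHp in b hp * => hab.
case: (boolP [exists i, (i != last) && (0 < b i)%N]); last first.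
  rewrite negb_exists => /forallP no.
  have b0 i : i != last -> b i = 0%N.
    by move=> il; have := no i; rewrite il /= -eqn0Ngt => /eqP.
  have [k lk] := base_exists; have rk := base_rainbow a b0 lk.
  rewrite (bigD1 k) //= rk big1 ?addr0 // => l lk'.
  case: (boolP (rainbow a b (G l))) => // rl.
  by rewrite (base_uniq b0 rl rk) eqxx in lk'.
case/existsP => i /andP[il bi].
pose b' i' := if i' == i then (b i).-1 else b i'.
have hb' : \sum_k (rainbow a b' (G k))%:R = 1 :> R.
  apply: IHp => [|i' i'l].
    apply: leq_trans (ltnSE hp); rewrite (bigD1 i) //= [X in (_ < X)%N](bigD1 i) //=.
    rewrite /b' eqxx -addSn prednK // leq_add2l; apply: leq_sum => i'.
    by case/andP => _ /negPf ->.
  have [j jT le_ba] := hab i' i'l; exists j => //; rewrite /b'.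
  by case: eqP => // i'i; rewrite -i'i (leq_trans (leq_pred _)).
rewrite -[RHS]hb'.
under eq_bigr do rewrite -cell_det_label //.
under [RHS]eq_bigr do rewrite -cell_det_label //.
apply/esym/(sum_det_step inj_a il); rewrite /b' ?eqxx ?prednK //; last exact: hab.
by move=> i' /negPf ->.
Qed.

End Sperner.

(** * Rooted trees and the hook formula *)

Section Hooks.
Variable J : 'I_N -> {set 'I_n}.
Local Notation G := (incidences J).
Hypothesis cG : cell G.

(** Connectedness in linear form: the functional of [f] vanishes on a basis. *)
Lemma cell_const (f : V -> R) :
  (forall e, e \in G -> f (inr e.2) = f (inl e.1)) ->
  forall v, f v = f (inl last).
Proof.
move=> hf v; apply/eqP; rewrite -subr_eq0 -vtx_mul; apply/eqP.
rewrite -/(potential f) (cell_kernel (y := potential f) cG).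
  by rewrite mulmx0 mxE.
by move=> e eG; rewrite edge_potential hf // subrr.
Qed.

Definition side (e : E) : {set V} :=
  [set v | connect (delete_vertex (bip_graph J) (inl e.1)) (inr e.2) v].

(* The part of the tree G that is cut off from the root by the edge e *)
Definition below (e : E) : {set V} :=
  if inl last \in side e then ~: side e else side e.

Lemma side_end e : inl e.1 \notin side e.
Proof.
rewrite inE; apply/negP.
move/(@closed_connect _ _ [pred v | v != inl e.1]) => /=.
rewrite !inE eqxx /= => h; suff : true = false by [].
by apply: h => u v /and3P[u1 v1 _]; rewrite !inE u1 v1.
Qed.

(** Deleting the vertex [e.1] cuts off the same part as deleting the edge [e]. The functional dual
    to [e] is constant on [side e]; a second edge from [e.1] into that part would therefore have
    value 1 instead of 0. *)
Lemma side_edge e f : e \in G -> f \in G -> f != e ->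
  (inr f.2 \in side e) = (inl f.1 \in side e).
Proof.
move=> eG fG fe; have [psi hpsi] := cell_dual cG.
pose P v := (vtx v *m psi e) 0 0.
have eP g : g \in G -> P (inr g.2) - P (inl g.1) = (g == e)%:R.
  by move=> gG; rewrite -hpsi // -dotBl.
have sideP v : v \in side e -> P v = P (inr e.2).
  rewrite inE => /(@closed_connect _ _ [pred v | P v == P (inr e.2)]).
  rewrite !inE eqxx => h; apply/eqP/esym/h => {h} -[i|j] [i'|j'] //=;
    rewrite /delete_vertex !inE => /and3P[ni nj /= gG] //.
    have := eP (i, j'); rewrite inE gG => /(_ isT) /=.
    have -> : ((i, j') == e) = false.
      by apply: contraNF ni => /eqP <-.
    by move/eqP; rewrite subr_eq0 => /eqP ->.
  have := eP (i', j); rewrite inE gG => /(_ isT) /=.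
  have -> : ((i', j) == e) = false.
    by apply: contraNF nj => /eqP <-.
  by move/eqP; rewrite subr_eq0 => /eqP ->.
case: (eqVneq f.1 e.1) => [f1|f1].
  rewrite [in RHS]f1 (negPf (side_end e)); apply/negP => /sideP Pf.
  have := eP f fG; rewrite (negPf fe) Pf f1 eP // eqxx => /eqP.
  by rewrite oner_eq0.
have f1' : inl f.1 != inl e.1 :> V by [].
rewrite !inE; apply/idP/idP => h; apply: (connect_trans h); apply: connect1;
  by rewrite /delete_vertex /= f1' /=; move: fG; rewrite inE.
Qed.

Lemma below_edge e f : e \in G -> f \in G -> f != e ->
  (inr f.2 \in below e) = (inl f.1 \in below e).
Proof.
by move=> eG fG fe; rewrite /below; case: ifP => _; rewrite ?finset.in_setC side_edge.
Qed.

Lemma below_ends e : (inr e.2 \in below e) = ~~ (inl e.1 \in below e).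
Proof.
have e2 : inr e.2 \in side e by rewrite inE connect0.
by rewrite /below; case: ifP => _; rewrite ?finset.in_setC ?e2 (negPf (side_end e)).
Qed.

Lemma below_last e : inl last \notin below e.
Proof. by rewrite /below; case: ifP => h; rewrite ?finset.in_setC h. Qed.

(** The two cases of [alpha] both count the unbarred vertices on the side of [e] away from the
    root. *)
Lemma alphaE e : N = (2 ^ n - 1)%N ->
  alpha last J e.1 e.2 = unbarred (below e).
Proof.
move=> hN; rewrite /alpha /unbarred /below -hN.
have -> : comp_set J e.1 e.2 = [set l | inl l \in side e].
  by apply/setP => l; rewrite !inE.
have -> : (last \in [set l | inl l \in side e]) = (inl last \in side e).
  by rewrite inE.
case: (boolP (inl last \in side e)) => h /=; last by [].
rewrite -[RHS](addKn #|[set l | inl l \in side e]|); congr (_ - _)%N.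
rewrite -[LHS]card_ord -(cardsC [set l | inl l \in side e]); congr (_ + _)%N.
by apply: eq_card => l; rewrite !inE.
Qed.

Definition child (e : E) : V :=
  if inr e.2 \in below e then inr e.2 else inl e.1.
Definition parent (e : E) : V :=
  if inr e.2 \in below e then inl e.1 else inr e.2.

Lemma child_below e : child e \in below e.
Proof. by rewrite /child; have := below_ends e; case: ifP => // _ /esym/negbFE. Qed.

Lemma parent_below e : parent e \notin below e.
Proof. by rewrite /parent; have := below_ends e; case: ifP => [_ /esym|-> _]. Qed.

Lemma child_nonroot e : child e \in nonroot.
Proof.
rewrite !inE; apply: contraTneq (child_below e) => ->; exact: below_last.
Qed.

Lemma child_parent_below e f : e \in G -> f \in G -> f != e ->
  (child f \in below e) = (parent f \in below e).
Proof.
by move=> eG fG fe; rewrite /child /parent; case: ifP => _;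
  rewrite below_edge.
Qed.

Lemma cell_const_child (f : V -> R) :
  (forall e, e \in G -> f (child e) = f (parent e)) ->
  forall v, f v = f (inl last).
Proof.
move=> hf; apply: cell_const => e /hf; rewrite /child /parent.
by case: ifP.
Qed.

(** If two edges shared a child, each parent would lie below the other edge. The indicator of being
    below neither edge would then be constant along all edges, yet it is 1 at the root and 0 at the
    child. *)
Lemma child_inj : {in G &, injective child}.
Proof.
move=> e1 e2 e1G e2G c12; apply/eqP; apply: contraTT isT => ne.
pose f v : R := ((v \notin below e1) && (v \notin below e2))%:R.
have := @cell_const_child f _ (child e1).
rewrite /f !below_last child_below /= => h; suff : (0 : R) = 1.
  by move/eqP; rewrite eq_sym oner_eq0.
apply: h => e eG.
case: (eqVneq e e1) => [->|ee1].
  rewrite child_below /= -(child_parent_below e2G e1G) // c12 child_below.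
  by rewrite andbF.
case: (eqVneq e e2) => [->|ee2].
  rewrite child_below /= andbF -(child_parent_below e1G e2G) 1?eq_sym //.
  by rewrite -c12 child_below.
by rewrite !(child_parent_below _ eG).
Qed.

Lemma child_imset : [set child e | e in G] = nonroot.
Proof.
apply/eqP; rewrite eqEcard card_in_imset ?cG.1 ?leqnn ?andbT; last exact: child_inj.
by apply/fintype.subsetP => _ /imsetP[e _ ->]; apply: child_nonroot.
Qed.

Definition parent_above (X : {set V}) (x : V) : bool :=
  [forall e in G, (child e == x) ==> (parent e \notin X)].

Lemma parent_above_child (X : {set V}) e : e \in G ->
  parent_above X (child e) = (parent e \notin X).
Proof.
move=> eG; apply/forall_inP/idP => [/(_ e eG)|pX f fG]; first by rewrite eqxx.
by apply/implyP => /eqP /(child_inj fG eG) ->.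
Qed.

Definition lower_closed (X : {set V}) :=
  forall e, e \in G -> child e \in X -> below e \subset X.

(** A lower closed set is the disjoint union of the subtrees hanging from its maximal vertices: the
    difference of the indicators is constant along edges and 0 at the root. *)
Lemma unbarred_roots (X : {set V}) : X \subset nonroot -> lower_closed X ->
  (unbarred X)%:R = \sum_(e in G | (child e \in X) && (parent e \notin X))
    (unbarred (below e))%:R :> R.
Proof.
move=> Xn Xc.
have lX : (inl last \in X) = false.
  by apply/negP => /(fintype.subsetP Xn); rewrite !inE eqxx.
pose f v : R := (v \in X)%:R -
  \sum_(e in G | (child e \in X) && (parent e \notin X)) (v \in below e)%:R.
have f0 v : f v = 0.
  rewrite (cell_const_child (f := f)) => [|g gG].
    rewrite /f lX sub0r big1 ?oppr0 // => e _.
    by rewrite (negPf (below_last e)).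
  rewrite /f; case: (boolP (child g \in X)) => cX; last first.
    have pX : parent g \notin X.
      apply: contra cX => pX; have : parent g \in nonroot by apply: (fintype.subsetP Xn).
      rewrite -child_imset => /imsetP[e eG pe].
      have ge : g != e.
        by apply: contraNneq (parent_below g) => ge; rewrite pe ge child_below.
      apply: (fintype.subsetP (Xc e eG _)); first by rewrite -pe.
      by rewrite child_parent_below // pe child_below.
    rewrite (negPf pX); congr (_ - _); apply: eq_bigr => e /and3P[eG ceX _].
    rewrite child_parent_below //; apply: contraNneq cX => ->.
    exact: ceX.
  case: (boolP (parent g \in X)) => pX.
    congr (_ - _); apply: eq_bigr => e /and3P[eG _ peX].
    by rewrite child_parent_below //; apply: contraNneq peX => <-.
  have Pg : [&& g \in G, child g \in X & parent g \notin X] by rewrite gG cX pX.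
  rewrite (bigD1 g) //= [in RHS](bigD1 g) //= child_below (negPf (parent_below g)).
  rewrite add0r opprD addrA subrr sub0r add0r; congr (- _).
  apply: eq_bigr => e /andP[/and3P[eG _ _] eg].
  by rewrite child_parent_below // eq_sym.
have unbarredE (Y : {set V}) : (unbarred Y)%:R = \sum_l (inl l \in Y)%:R :> R.
  rewrite -natr_sum /unbarred -sum1_card big_mkcond /=; congr (_%:R).
  by apply: eq_bigr => l _; rewrite inE; case: (_ \in _).
rewrite (eq_bigr _ (fun e _ => unbarredE (below e))) unbarredE exchange_big /=.
apply: eq_bigr => l _.
by have /eqP := f0 (inl l); rewrite subr_eq0 => /eqP.
Qed.

(** By induction on [X]: the largest element has its parent outside [X], and removing it removes the
    factor of its hook. By [unbarred_roots] these hooks add up to [unbarred X], which cancels the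
    weight of the first step. *)
Lemma hook_formula (X : {set V}) : (forall e, e \in G -> (0 < unbarred (below e))%N) ->
  X \subset nonroot -> lower_closed X ->
  weighted_orders R parent_above X =
  \prod_(e in G | child e \in X) (unbarred (below e))%:R^-1.
Proof.
move=> pos; have [p] := ubnP #|X|; elim: p => // p IHp in X * => hp Xn Xc.
case: (eqVneq X finset.set0) => [->|X0].
  by rewrite weighted_orders0 big1 // => e; rewrite finset.in_set0 andbF.
rewrite weighted_ordersE //.
have -> : \sum_(x in X | parent_above X x) weighted_orders R parent_above (X :\ x) =
   \sum_(e in G | (child e \in X) && (parent e \notin X))
     (unbarred (below e))%:R *
     \prod_(f in G | child f \in X) (unbarred (below f))%:R^-1 :> R.
  transitivity (\sum_(x in nonroot | (x \in X) && parent_above X x)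
      weighted_orders R parent_above (X :\ x)).
    apply: eq_bigl => x; rewrite andbA [X in _ = X && _]andb_idl //.
    exact: (fintype.subsetP Xn).
  rewrite -child_imset big_imset_cond /=; last exact: child_inj.
  apply: eq_big => [e|e /and3P[eG cX pX]].
    by apply: andb_id2l => eG; rewrite parent_above_child.
  rewrite parent_above_child // in pX.
  rewrite IHp.
  - rewrite [in RHS](bigD1 e) ?eG //= mulrA mulfV ?mul1r; last first.
      by rewrite pnatr_eq0 -lt0n pos.
    apply: eq_bigl => f; rewrite in_setD1; case: (boolP (f \in G)) => //= fG.
    by rewrite andbC; congr (_ && ~~ _); apply/eqP/eqP => [/(child_inj fG eG)|->].
  - by have := cardsD1 (child e) X; rewrite cX => h; rewrite h in hp.
  - by apply: fintype.subset_trans Xn; rewrite subD1set.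
  move=> f fG; rewrite in_setD1 => /andP[fe fX].
  rewrite subsetD1 Xc //=; apply: contra pX => ceb.
  apply: (fintype.subsetP (Xc f fG fX)); rewrite -child_parent_below //.
  by apply: contraNneq fe => ->.
rewrite -mulr_suml -unbarred_roots // mulrA mulVf ?mul1r //.
have [x xX] := set0Pn _ X0.
have /imsetP[e eG xe] : x \in [set child e | e in G].
  by rewrite child_imset; apply: (fintype.subsetP Xn).
rewrite pnatr_eq0 -lt0n (leq_trans (pos e eG)) // subset_leq_card //.
apply/fintype.subsetP => l; rewrite !inE.
by apply: (fintype.subsetP (Xc e eG _)); rewrite -xe.
Qed.

Lemma below_leaf e : e \in G -> J e.1 = [set e.2] -> e.1 != last ->
  below e = [set inl e.1].
Proof.
move=> eG Je el.
have leaf f : f \in G -> f.1 = e.1 -> f = e.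
  move=> fG f1; have : f.2 \in J e.1 by rewrite -f1; move: fG; rewrite inE.
  by rewrite Je inE => /eqP f2; case: f e f1 f2 {eG Je el fG} => ? ? [? ?] /= -> ->.
have el' : (inl last == inl e.1 :> V) = false.
  by apply/negP => /eqP [le]; rewrite -le eqxx in el.
(* Correcting the indicator of [below e] by [c] at the leaf makes it constant along [e] too, hence 0
   everywhere. The value [c = 1] fails at [inr e.2], and [c = -1] gives the claim. *)
have const (c : R) : ((inr e.2 \in below e)%:R : R) = (inl e.1 \in below e)%:R + c ->
    forall v, (v \in below e)%:R + (v == inl e.1)%:R * c = 0.
  move=> hc v.
  rewrite (cell_const (f := fun v => (v \in below e)%:R + (v == inl e.1)%:R * c)).
    by rewrite (negPf (below_last e)) el' mul0r addr0.
  move=> f fG; case: (eqVneq f e) => [->|fe].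
    by rewrite eqxx mul1r mul0r addr0 hc.
  rewrite (below_edge eG fG fe); congr (_ + _ * _).
  rewrite [RHS](_ : _ = 0) //; apply/eqP; rewrite pnatr_eq0 eqb0.
  by apply: contra fe => /eqP [f1]; rewrite (leaf f).
have e2 : inr e.2 \notin below e.
  apply/negP => e2; have := const 1; rewrite e2.
  have := below_ends e; rewrite e2 => /esym/negPf ->.
  move=> /(_ (esym (add0r 1)) (inr e.2)) /eqP.
  by rewrite e2 mul0r addr0 oner_eq0.
have e1 : inl e.1 \in below e by rewrite -[_ \in _]negbK -below_ends.
apply/setP => v; have := const (-1).
rewrite (negPf e2) e1 subrr => /(_ erefl v) /eqP.
rewrite !inE mulrN1 subr_eq0 eqr_nat.
by case: (v \in below e); case: (v == _).
Qed.

Lemma below_root_leaf e : e \in G -> J e.1 = [set e.2] -> e.1 = last ->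
  below e = nonroot.
Proof.
move=> eG Je el.
have e1 : inl e.1 \notin below e by rewrite el below_last.
apply/setP => v; have : (v \in below e)%:R + (v == inl last)%:R = 1 :> R.
  rewrite (cell_const (f := fun v => (v \in below e)%:R + (v == inl last)%:R)).
    by rewrite (negPf (below_last e)) eqxx add0r.
  move=> f fG; case: (eqVneq f e) => [->|fe].
    by rewrite below_ends el eqxx (negPf (below_last e)) addrC.
  rewrite (below_edge eG fG fe); congr (_ + _).
  rewrite [RHS](_ : _ = 0) //; apply/eqP; rewrite pnatr_eq0 eqb0.
  apply: contra fe => /eqP [f1].
  have : f.2 \in J e.1 by rewrite el -f1; move: fG; rewrite inE.
  rewrite Je inE => /eqP f2; apply/eqP.
  by case: f f1 f2 {fG} => ? ? /= -> ->; rewrite -el; case: (e).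
rewrite -natrD => /eqP; rewrite pnatr_eq1 !inE.
by case: (v \in below e); case: (v == _).
Qed.

End Hooks.

(** * Double counting of cells and orders *)

Section Assembly.

(** Ranks are counted from the end of the list, since the list starts with the largest vertex. *)
Definition rank_barred (s : seq V) (j : 'I_n) : nat := size s - index (inr j) s.
Definition rank_unbarred (s : seq V) (i : 'I_N) : nat := size s - index (inl i) s.

Section Order.
Variable s : seq V.
Hypotheses (us : uniq s) (sX : s =i nonroot).
Local Notation a := (rank_barred s).
Local Notation b := (rank_unbarred s).

Let index_lt v : v \in nonroot -> (index v s < size s)%N.
Proof. by rewrite index_mem sX. Qed.

Let inr_nonroot (j : 'I_n) : inr j \in nonroot. Proof. by rewrite !inE. Qed.

Let inl_nonroot (i : 'I_N) : (inl i \in nonroot) = (i != last).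
Proof. by rewrite !inE. Qed.

Let index_neq (i : 'I_N) (j : 'I_n) : i != last ->
  index (inl i : V) s <> index (inr j : V) s.
Proof.
rewrite -inl_nonroot => il eq_ij.
suff : inl i = inr j :> V by [].
have /(nth_index (inl i)) <- : (inl i : V) \in s by rewrite sX.
have /(nth_index (inl i)) <- : (inr j : V) \in s by rewrite sX inr_nonroot.
by rewrite eq_ij.
Qed.

Lemma rank_lt i j : i != last ->
  (a j < b i)%N = (index (inl i : V) s < index (inr j : V) s)%N.
Proof.
rewrite -inl_nonroot => il.
have hi : (index (inl i : V) s < size s)%N := index_lt il.
have hj : (index (inr j : V) s < size s)%N := index_lt (inr_nonroot j).
have subn_lt p q r : (p < r -> q < r -> (r - q < r - p) = (p < q))%N by lia.
exact: subn_lt hi hj.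
Qed.

Lemma rank_le i j : i != last ->
  (b i <= a j)%N = (index (inr j : V) s < index (inl i : V) s)%N.
Proof.
move=> il; rewrite leqNgt rank_lt // -leqNgt leq_eqVlt.
by case: eqP => // eq_ij; case: (index_neq il (esym eq_ij)).
Qed.

Lemma rank_barred_inj : injective a.
Proof.
move=> j j'.
have hj : (index (inr j : V) s < size s)%N := index_lt (inr_nonroot j).
have hj' : (index (inr j' : V) s < size s)%N := index_lt (inr_nonroot j').
have subn_eq p q r : (p < r -> q < r -> r - p = r - q -> p = q)%N by lia.
move=> /(subn_eq _ _ _ hj hj') e.
suff [] : inr j = inr j' :> V by [].
have /(nth_index (inr j)) <- : (inr j : V) \in s by rewrite sX inr_nonroot.
have /(nth_index (inr j)) <- : (inr j' : V) \in s by rewrite sX inr_nonroot.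
by rewrite e.
Qed.

Lemma labelP (e : E) :
  (label a b e = inr e.2 /\
     (e.1 = last \/ (index (inl e.1 : V) s < index (inr e.2 : V) s)%N)) \/
  [/\ label a b e = inl e.1, e.1 != last &
     (index (inr e.2 : V) s < index (inl e.1 : V) s)%N].
Proof.
rewrite /label; case: (eqVneq e.1 last) => [->|il] /=; first by left; split; [|left].
rewrite rank_lt //; case: ifP => lt_ij; first by left; split; [|right].
by right; split; rewrite // -rank_le // leqNgt rank_lt // lt_ij.
Qed.

Variable J : 'I_N -> {set 'I_n}.
Local Notation G := (incidences J).
Hypothesis cG : cell G.

Lemma admissible_parentP :
  reflect (forall e, e \in G -> parent J e \in nonroot ->
             (index (parent J e) s < index (child J e) s)%N)
    (admissible (parent_above J) nonroot s).
Proof.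
apply: (iffP (admissibleP _ us sX)) => [h e eG pn|h x xn].
  have := h _ (child_nonroot J e).
  by rewrite (parent_above_child cG) // inE pn /= -ltnNge.
have /imsetP[e eG ->] : x \in [set child J e | e in G] by rewrite (child_imset cG).
rewrite (parent_above_child cG) // inE negb_and -ltnNge.
by case: (boolP (parent J e \in nonroot)) => //= /(h e eG).
Qed.

(** If parents are above children, labels are children and hence distinct. Conversely, distinct
    labels must be the children, as an induction from the top of the order shows. *)
Lemma admissible_rainbow :
  admissible (parent_above J) nonroot s = rainbow a b G.
Proof.
have dG : #|G| = d by case: cG.
apply/admissible_parentP/idP => [h|rG e eG pn].
  suff lab : {in G, label a b =1 child J}.
    apply/imset_injP => e f eG fG; rewrite !lab //.
    exact: (child_inj cG eG fG).
  move=> e eG; have := h e eG; have := child_nonroot J e.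
  rewrite /child /parent; case: ifP => _.
    rewrite inl_nonroot => _; case: (labelP e) => [[-> //]|[_ il lt_ji]].
    by move=> /(_ il) /ltn_trans /(_ lt_ji); rewrite ltnn.
  rewrite inl_nonroot => il; rewrite inr_nonroot => /(_ isT).
  case: (labelP e) => [[_ [e1|lt_ij]]|[]] //; first by rewrite e1 eqxx in il.
  by move=> /ltn_trans /(_ lt_ij); rewrite ltnn.
have lab f : f \in G -> label a b f = child J f.
  (* If the label of [f] is not its child, the child is higher and labels some [g]; by induction it
     is the child of [g], so [g = f], a contradiction. *)
  have [p hp] := ubnP (index (label a b f) s).
  elim: p => // p IHp in f hp * => fG.
  apply/eqP; apply: contraT => ne.
  have cn := child_nonroot J f.
  have lt_cl : (index (child J f) s < index (label a b f) s)%N.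
    move: ne cn; rewrite /child; case: ifP => _; case: (labelP f) => [[-> hl]|[-> hl hi]] //;
      rewrite ?eqxx // inl_nonroot.
    by case: hl => // ->; rewrite eqxx.
  have [g gG gE] := rainbow_label dG rG cn.
  have := IHp g _ gG; rewrite gE (leq_trans lt_cl) // => /(_ isT) /esym.
  move=> /(child_inj cG gG fG) gf.
  by move: gE ne; rewrite gf => ->; rewrite eqxx.
have := lab e eG; move: pn; rewrite /child /parent; case: ifP => _.
  rewrite inl_nonroot => il; case: (labelP e) => [[_ [e1|//]]|[-> //]].
  by rewrite e1 eqxx in il.
by move=> _; case: (labelP e) => [[->]|[]].
Qed.

End Order.

Variables (T : 'I_N -> {set 'I_n}) (m : nat) (J : 'I_m -> 'I_N -> {set 'I_n}).
Hypothesis hN : N = (2 ^ n - 1)%N.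
Hypothesis Tinj : injective T.
Hypothesis Tall : forall S : {set 'I_n}, S != finset.set0 -> exists i, T i = S.
Hypothesis Tlast : T last = [set: 'I_n].
Hypothesis T_neq0 : forall i, T i != finset.set0.
Hypothesis J_neq0 : forall k i, J k i != finset.set0.
Hypothesis triJ : cone_triangulation (incidences T) (fun k => incidences (J k)).

Let G_cell k : cell (incidences (J k)). Proof. by case: triJ. Qed.
Let G_sub k : incidences (J k) \subset incidences T. Proof. by case: triJ. Qed.

Definition some_barred_above (X : {set V}) (x : V) : bool :=
  if x is inl i then [exists j in T i, inr j \notin X] else true.

(** In a rainbow cell, the edge labelled [i] leads to some [j] in [T i] above [i]; so an order
    without such a [j] is compatible with no cell, and any other order is covered by
    [rainbow_cell_uniq]. *)
Lemma admissible_count s : uniq s -> s =i nonroot ->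
  \sum_k (admissible (parent_above (J k)) nonroot s)%:R =
  (admissible some_barred_above nonroot s)%:R :> R.
Proof.
move=> us sX.
under eq_bigr do rewrite (admissible_rainbow us sX (G_cell _)).
case: (boolP (admissible _ _ _)) => [/(admissibleP _ us sX) adm|nadm].
  apply: (rainbow_cell_uniq Tlast triJ) => [i|k i||i il].
  - by have /set0Pn[j] := T_neq0 i; exists j.
  - by have /set0Pn[j jJ] := J_neq0 k i; exists j; rewrite inE.
  - exact: rank_barred_inj.
  have iln : inl i \in nonroot by rewrite !inE.
  have /exists_inP[j jT] := adm _ iln; rewrite !inE /= -ltnNge => lt_ji.
  by exists j => //; rewrite rank_le.
rewrite big1 // => k _; case: (boolP (rainbow _ _ _)) => // rG.
case/negP: nadm; apply/(admissibleP _ us sX) => -[i|//] iln.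
have il : i != last by apply: contraTneq iln => ->; rewrite !inE eqxx.
have [e eG le] := rainbow_label (G_cell k).1 rG iln.
case: (labelP us sX e) => [[]|[]]; rewrite le // => -[ei] el lt_ji.
apply/exists_inP; exists e.2; last by rewrite !inE /= -ltnNge ei.
by have := fintype.subsetP (G_sub k) e eG; rewrite inE ei.
Qed.

(** The total weight of the orders of a set with [p < n] barred vertices, by
    [weighted_orders_barred]. *)
Definition order_total (p : nat) : R :=
  (p`!)%:R / \prod_(1 <= k < p.+1) (2 ^+ k - 1).

Lemma pow2_gt1 k : (0 < k)%N -> (0 : R) < 2 ^+ k - 1.
Proof. by move=> k0; rewrite subr_gt0 exprn_egt1 // ?ltr1n // -lt0n. Qed.

Lemma order_totalS p : p%:R * order_total p.-1 = (2 ^+ p - 1) * order_total p.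
Proof.
case: p => [|p]; first by rewrite expr0 subrr !mul0r.
rewrite /order_total [in RHS]big_nat_recr //= factS natrM.
have nz : \prod_(1 <= k < p.+1) (2 ^+ k - 1 : R) != 0.
  rewrite gt_eqF // big_nat_cond.
  elim/big_ind: _ => // [x y|k /andP[/andP[k0 _] _]]; first exact: mulr_gt0.
  exact: pow2_gt1.
have nz' : (2 ^+ p.+1 - 1 : R) != 0 by rewrite gt_eqF // pow2_gt1.
by field; rewrite nz nz'.
Qed.

Definition barred (X : {set V}) : {set 'I_n} := [set j | inr j \in X].

Lemma card_subsets (S : {set 'I_n}) : #|[set i | T i \subset S]| = (2 ^ #|S| - 1)%N.
Proof.
rewrite -(card_imset _ Tinj).
have -> : T @: [set i | T i \subset S] = powerset S :\ finset.set0.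
  apply/setP => A; rewrite !inE; apply/imsetP/andP => [[i iS ->]|[A0 AS]].
    by split; [exact: T_neq0 | rewrite inE in iS].
  by have [i iA] := Tall A0; exists i; rewrite ?inE iA.
have := cardsD1 finset.set0 (powerset S).
by rewrite card_powerset powersetE finset.sub0set => ->; rewrite addKn.
Qed.

Lemma sum_some_barred (X : {set V}) (F : V -> R) :
  \sum_(x in X | some_barred_above X x) F x =
  \sum_(i | (inl i \in X) && ~~ (T i \subset barred X)) F (inl i) +
  \sum_(j in barred X) F (inr j).
Proof.
rewrite big_sumType /=; congr (_ + _); apply: eq_bigl => t; last first.
  by rewrite inE andbT.
congr (_ && _); apply/exists_inP/fintype.subsetPn => -[j jT jX]; exists j => //.
  by rewrite inE.
by move: jX; rewrite inE.
Qed.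

(** The total depends only on [p], the number of barred vertices. A largest element is one of the
    [c] vertices [i] with [T i] not inside the barred part, which keeps [p], or one of the [p]
    barred vertices. The recursion closes because [unbarred X = c + (2 ^ p - 1)]. *)
Lemma weighted_orders_barred (X : {set V}) : X \subset nonroot ->
  barred X != [set: 'I_n] ->
  (forall i, T i \subset barred X -> inl i \in X) ->
  weighted_orders R some_barred_above X = order_total #|barred X|.
Proof.
have [p] := ubnP #|X|; elim: p => // p IHp in X * => hp Xn XT Xc.
case: (eqVneq X finset.set0) => [X0|X0].
  have -> : barred X = finset.set0 by apply/setP => j; rewrite X0 !inE.
  by rewrite X0 weighted_orders0 cards0 /order_total big_nil divr1.
rewrite weighted_ordersE // sum_some_barred.
set S := barred X in XT Xc *.
have cardD x : x \in X -> (#|X :\ x| < p)%N.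
  by move=> xX; have := cardsD1 x X; rewrite xX => h; rewrite h in hp.
have subD x : X :\ x \subset nonroot.
  by apply: fintype.subset_trans Xn; rewrite subD1set.
have barl i : barred (X :\ inl i) = S by apply/setP => j; rewrite !inE.
have barr j : barred (X :\ inr j) = S :\ j.
  by apply/setP => j'; rewrite !inE.
have suml : \sum_(i | (inl i \in X) && ~~ (T i \subset S))
    weighted_orders R some_barred_above (X :\ inl i) =
    #|[set i | (inl i \in X) && ~~ (T i \subset S)]|%:R * order_total #|S|.
  rewrite (eq_bigr (fun=> order_total #|S|)).
    by rewrite big_const iter_addr_0 mulr_natl; congr (_ *+ _); apply: eq_card => i; rewrite !inE.
  move=> i /andP[iX iS]; rewrite IHp ?barl ?cardD // => i' i'S.
  rewrite !inE Xc // andbT; apply: contraNneq iS => -[<-]; exact: i'S.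
have sumr : \sum_(j in S) weighted_orders R some_barred_above (X :\ inr j) =
    #|S|%:R * order_total #|S|.-1.
  rewrite (eq_bigr (fun=> order_total #|S|.-1)).
    by rewrite big_const iter_addr_0 mulr_natl.
  move=> j jS; have jX : inr j \in X by move: jS; rewrite inE.
  rewrite IHp ?barr ?cardD //.
  - by have := cardsD1 j S; rewrite jS => ->.
  - by apply/eqP => /setP /(_ j); rewrite !inE eqxx.
  - by move=> i iS; rewrite !inE Xc // (fintype.subset_trans iS) ?subD1set.
have cardX : unbarred X =
    (#|[set i | (inl i \in X) && ~~ (T i \subset S)]| + (2 ^ #|S| - 1))%N.
  rewrite /unbarred -card_subsets addnC.
  rewrite -(cardsID [set i | T i \subset S]); congr (_ + _)%N; apply: eq_card => i.
    rewrite !inE andb_idl //; exact: Xc.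
  by rewrite !inE andbC.
have pow2E : (2 ^ #|S| - 1)%:R = 2 ^+ #|S| - 1 :> R.
  by rewrite natrB ?expn_gt0 // natrX.
rewrite suml sumr order_totalS -mulrDl -pow2E -natrD -cardX mulrA mulVf ?mul1r //.
rewrite pnatr_eq0; apply: contra X0; rewrite cardX addn_eq0 => /andP[f0 s0].
have S0 : S = finset.set0.
  apply/eqP; rewrite -cards_eq0; move: s0; rewrite subn_eq0.
  by case: #|S| => // c; rewrite expnS; have := expn_gt0 2 c; lia.
apply/eqP/setP => -[i|j]; last first.
  by have := congr1 (fun A : {set 'I_n} => j \in A) S0; rewrite !inE.
rewrite finset.in_set0; apply/negP => iX.
have : i \in [set i | (inl i \in X) && ~~ (T i \subset S)].
  by rewrite inE iX S0 finset.subset0 T_neq0.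
by move: f0; rewrite cards_eq0 => /eqP ->; rewrite inE.
Qed.

Lemma unbarred_nonroot : unbarred nonroot = N.-1.
Proof.
rewrite /unbarred -[N in RHS]card_ord -(cardsC1 last); apply: eq_card => i.
by rewrite !inE.
Qed.

(** Nothing lies above the largest vertex, so it must be barred; removing it leaves [n - 1] barred
    vertices. *)
Lemma weighted_orders_all : (1 < n)%N ->
  weighted_orders R some_barred_above nonroot =
  (N.-1)%:R^-1 * (n%:R * order_total n.-1).
Proof.
move=> n1.
have barredT : barred nonroot = [set: 'I_n] by apply/setP => j; rewrite !inE.
have j0 : 'I_n by apply: (Ordinal n1).
rewrite weighted_ordersE; last first.
  by apply/set0Pn; exists (inr j0); rewrite !inE.
rewrite unbarred_nonroot; congr (_ * _); rewrite sum_some_barred big_pred0 ?add0r; last first.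
  by move=> i; rewrite barredT finset.subsetT andbF.
rewrite barredT (eq_bigr (fun=> order_total n.-1)).
  by rewrite big_const iter_addr_0 mulr_natl cardsT card_ord.
have barr (j : 'I_n) : barred (nonroot :\ inr j) = [set~ j].
  by apply/setP => j'; rewrite !inE andbT.
move=> j _; have := @weighted_orders_barred (nonroot :\ inr j).
rewrite barr cardsC1 card_ord; apply; first exact: subD1set.
  by apply/eqP => /setP /(_ j); rewrite !inE eqxx.
move=> i ij; rewrite !inE /=; apply: contraTneq ij => -[->]; rewrite Tlast.
by apply/negP => /fintype.subsetP /(_ j); rewrite !inE eqxx => /(_ isT).
Qed.

Theorem sum_hooks : (1 < n)%N ->
  \sum_k \prod_(e in incidences (J k))
    (alpha last (J k) e.1 e.2)%:R^-1 = (N.-1)%:R^-1 * (n%:R * order_total n.-1).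
Proof.
move=> n1; rewrite -weighted_orders_all //.
have nonroot_closed k : lower_closed (J k) nonroot.
  move=> e eG _; apply/fintype.subsetP => v vb; rewrite !inE.
  by apply: contraTneq vb => ->; apply: below_last.
(* If the child of [e] is barred, the singleton summand at [e.2] is joined to it in every cell, and
   so lies below [e] or is itself the leaf end of [e]. *)
have pos k e : e \in incidences (J k) -> (0 < unbarred (below (J k) e))%N.
  move=> eG; rewrite card_gt0; apply/set0Pn.
  have := child_below (J k) e; rewrite /child; case: ifP => _ ce; last first.
    by exists e.1; rewrite inE.
  have [i0 Ti0] : exists i, T i = [set e.2] by apply: Tall; apply/set0Pn; exists e.2; rewrite inE.
  have [j jJ] := set0Pn _ (J_neq0 k i0).
  have jE : j = e.2.
    have /(fintype.subsetP (G_sub k)) : (i0, j) \in incidences (J k) by rewrite inE.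
    by rewrite inE Ti0 inE => /eqP.
  have fG : (i0, e.2) \in incidences (J k) by rewrite inE -jE.
  case: (eqVneq (i0, e.2) e) => [fe|fe].
    have e1 : i0 = e.1 := congr1 fst fe.
    have Je : J k e.1 = [set e.2].
      apply/eqP; rewrite finset.eqEsubset finset.sub1set -e1 -{2}jE jJ andbT -Ti0.
      apply/fintype.subsetP => j' j'J.
      have := fintype.subsetP (G_sub k) (i0, j'); rewrite !inE /=; exact.
    have el : e.1 != last.
      apply: contraTneq n1 => el; have := congr1 (fun A : {set 'I_n} => #|A|) Ti0.
      by rewrite e1 el Tlast cardsT card_ord cards1 => ->.
    by exists e.1; rewrite (below_leaf (G_cell k) eG Je el) !inE.
  exists i0; rewrite inE.
  by have := below_edge (G_cell k) eG fG fe => /= <-.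
have hook k : \prod_(e in incidences (J k)) (alpha last (J k) e.1 e.2)%:R^-1 =
    weighted_orders R (parent_above (J k)) nonroot.
  rewrite (hook_formula (G_cell k)) //; last exact: pos.
  apply: eq_big => [e|e _]; last by rewrite alphaE.
  by rewrite child_nonroot andbT.
under eq_bigr do rewrite hook.
(* The sum over cells goes inside the sum over orders, where it counts compatible cells. *)
rewrite /weighted_orders -order_sum_sum; apply: eq_order_sum => // s us sX.
by rewrite -mulr_suml admissible_count.
Qed.

End Assembly.

End Trees.

(** * From the Cayley polytope to the cone of edge vectors *)

Section Cayley.
Local Open Scope set_scope.
Variables (R : realType) (n N : nat) (last : 'I_N).
Local Notation V := ('I_N + 'I_n)%type.
Local Notation E := ('I_N * 'I_n)%type.
Local Notation nonroot := (@nonroot n N last).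
Local Notation d := #|nonroot|.
Local Notation vtx := (@vtx R n N last).
Local Notation edge_vec := (@edge_vec R n N last).
Local Notation cayley := (@cayley_point R n N).

Lemma vtx_mulmx q (f : V -> 'rV[R]_q) v : f (inl last) = 0 ->
  vtx v *m (\matrix_(c < d) f (enum_val c)) = f v.
Proof.
move=> f0; apply/rowP => k.
have fk : f (inl last) 0 k = 0 by rewrite f0 mxE.
have := @vtx_mul R n N last (fun u => f u 0 k) v; rewrite fk subr0 => <-.
by rewrite !mxE; apply: eq_bigr => c _; rewrite !mxE subr0.
Qed.

(** Linear maps in both directions exchange Cayley points and edge vectors, so both families satisfy
    the same linear relations. *)
Lemma cayley_edge_eq (A A' : {set E}) (F F' : E -> R) :
  (\sum_(e in A) F e *: cayley e = \sum_(e in A') F' e *: cayley e) <->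
  (\sum_(e in A) F e *: edge_vec e = \sum_(e in A') F' e *: edge_vec e).
Proof.
pose to_edge : 'M[R]_(n + N, d) :=
  col_mx (\matrix_j vtx (inr j)) (\matrix_i - vtx (inl i)).
have to_edgeE e : cayley e *m to_edge = edge_vec e.
  by rewrite /cayley_point mul_row_col -!rowE !rowK.
(* Vertex [j] goes to the Cayley point of the root edge at [j], and [i] to [(0, f_last - f_i)], so
   the root goes to 0 and the difference is [(e_j, f_i)]. *)
pose of_vtx (v : V) : 'rV[R]_(n + N) := match v with
  | inr j => cayley (last, j)
  | inl i => row_mx 0 (delta_mx 0 last - delta_mx 0 i) end.
have of_last : of_vtx (inl last) = 0 by rewrite /of_vtx subrr row_mx0.
have of_edgeE e : edge_vec e *m (\matrix_(c < d) of_vtx (enum_val c)) = cayley e.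
  rewrite (mulmxBl (vtx (inr e.2)) (vtx (inl e.1))) !vtx_mulmx // /of_vtx /cayley_point /=.
  by rewrite opp_row_mx add_row_mx oppr0 addr0 opprB addrC subrK.
have mulS q (M : 'M[R]_(_, q)) (x : E -> 'rV[R]_d) (B : {set E}) (H : E -> R) :
    (\sum_(e in B) H e *: x e) *m M = \sum_(e in B) H e *: (x e *m M).
  by rewrite mulmx_suml; apply: eq_bigr => e _; rewrite scalemxAl.
have mulS' q (M : 'M[R]_(_, q)) (x : E -> 'rV[R]_(n + N)) (B : {set E}) (H : E -> R) :
    (\sum_(e in B) H e *: x e) *m M = \sum_(e in B) H e *: (x e *m M).
  by rewrite mulmx_suml; apply: eq_bigr => e _; rewrite scalemxAl.
split=> [/(congr1 (fun x => x *m to_edge))|].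
  by rewrite !mulS'; under eq_bigr do rewrite to_edgeE;
    under [RHS]eq_bigr do rewrite to_edgeE.
move/(congr1 (fun x => x *m (\matrix_(c < d) of_vtx (enum_val c)))).
by rewrite !mulS; under eq_bigr do rewrite of_edgeE;
  under [RHS]eq_bigr do rewrite of_edgeE.
Qed.

(** Cayley points lie on the hyperplane where the first [n] coordinates sum to 1. *)
Lemma sum_coef_eq (A A' : {set E}) (F F' : E -> R) :
  \sum_(e in A) F e *: cayley e = \sum_(e in A') F' e *: cayley e ->
  \sum_(e in A) F e = \sum_(e in A') F' e.
Proof.
pose s : 'cV[R]_(n + N) := col_mx (const_mx 1) 0.
have cs e : (cayley e *m s) 0 0 = 1.
  by rewrite /cayley_point mul_row_col mulmx0 addr0 -rowE !mxE.
have sumE (B : {set E}) (H : E -> R) :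
    ((\sum_(e in B) H e *: cayley e) *m s) 0 0 = \sum_(e in B) H e.
  by rewrite dot_suml; apply: eq_bigr => e _; rewrite dotZl cs mulr1.
by move/(congr1 (fun x => (x *m s) 0 0)); rewrite !sumE.
Qed.

Lemma card_incidences (J : 'I_N -> {set 'I_n}) :
  #|incidences J| = (\sum_i #|J i|)%N.
Proof.
rewrite -sum1_card big_set_if; apply: eq_bigr => i _.
by rewrite -sum1_card [RHS]big_mkcond; apply: eq_bigr => j _; rewrite inE.
Qed.

Lemma incidences_inj (J J' : {ffun 'I_N -> {set 'I_n}}) :
  incidences J = incidences J' -> J = J'.
Proof.
move=> JJ; apply/ffunP => i; apply/setP => j.
by have := congr1 (fun A : {set E} => (i, j) \in A) JJ; rewrite !inE.
Qed.

Lemma incidences_cell (J : 'I_N -> {set 'I_n}) : (0 < n)%N ->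
  (forall i, J i != finset.set0) -> (\sum_i (#|J i| - 1) = n - 1)%N ->
  affinely_independent cayley (incidences J) ->
  cell R last (incidences J).
Proof.
move=> n0 J0 cJ ind; split.
  rewrite card_incidences card_nonroot.
  have : (\sum_i #|J i| = \sum_i (#|J i| - 1) + \sum_(i < N) 1)%N.
    by rewrite -big_split; apply: eq_bigr => i _ /=; rewrite subnK // card_gt0.
  by rewrite cJ sum1_card card_ord => ->; lia.
move=> c c0; have c0' : \sum_(e in incidences J) c e *: cayley e = 0.
  have := (cayley_edge_eq (incidences J) finset.set0 c (fun=> 0)).2.
  by rewrite !big_set0 => ->.
apply: (ind c) => //.
by have := @sum_coef_eq (incidences J) finset.set0 c (fun=> 0);
  rewrite !big_set0 => ->.
Qed.

(** Dividing by the sum of coefficients passes between cones and convex hulls. For properness, a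
    common point lies in the hull of a common face, and independence in each cell identifies both
    coordinate families with the one on that face. *)
Lemma cayley_cone_triangulation (T : 'I_N -> {set 'I_n}) m
    (J : 'I_m -> {ffun 'I_N -> {set 'I_n}}) : (0 < n)%N ->
  fine_mixed_subdivision R T J ->
  cone_triangulation R last (incidences T) (fun k => incidences (J k)).
Proof.
move=> n0 [injJ J0 _ cJ [subJ indJ _ covJ capJ]].
have cellJ k : cell R last (incidences (J k)).
  by apply: incidences_cell => // i; case: (J0 k i).
split=> //.
- by move=> k l /incidences_inj /injJ.
- move=> lam lam_ge0; set s := \sum_(e in _) lam e => s_gt0.
  have : conv cayley (incidences T)
      (\sum_(e in incidences T) (lam e / s) *: cayley e).
    exists (fun e => lam e / s); split => //.
      by move=> e eT; rewrite divr_ge0 ?lam_ge0 // ltW.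
    by rewrite -mulr_suml divff // gt_eqF.
  rewrite covJ => -[k _ [c [c_ge0 _ cE]]].
  exists k, (fun e => s * c e); split.
    by move=> e eJ; rewrite mulr_ge0 ?c_ge0 // ltW.
  apply/cayley_edge_eq; under [RHS]eq_bigr do rewrite -scalerA.
  rewrite -scaler_sumr -cE scaler_sumr; apply: eq_bigr => e _.
  by rewrite scalerA mulrCA divff ?mulr1 // gt_eqF.
move=> k l lam mu lam_ge0 mu_ge0 /cayley_edge_eq eq_lm e.
have eq_s := sum_coef_eq eq_lm.
set s := \sum_(e in incidences (J k)) lam e in eq_s.
have s_ge0 : 0 <= s by apply: sumr_ge0.
have [s0|s_neq0] := eqVneq s 0.
  have lam0 f : f \in incidences (J k) -> lam f = 0.
    move=> fJ; apply/eqP; have := s0; rewrite /s => /eqP.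
    by rewrite psumr_eq0 // => /allP /(_ f (mem_index_enum f)); rewrite fJ.
  have mu0 f : f \in incidences (J l) -> mu f = 0.
    move=> fJ; apply/eqP; have := s0; rewrite eq_s => /eqP.
    by rewrite psumr_eq0 // => /allP /(_ f (mem_index_enum f)); rewrite fJ.
  by case: ifP => [/lam0 ->|_]; case: ifP => [/mu0 ->|_].
have s_gt0 : 0 < s by rewrite lt_neqAle eq_sym s_neq0.
have [F [nu [Fk Fl nuE]]] : exists (F : {set E}) (nu : E -> R), [/\ F \subset incidences (J k),
    F \subset incidences (J l) &
    \sum_(e in incidences (J k)) lam e *: cayley e =
    \sum_(e in F) nu e *: cayley e].
  have [<-|kl] := eqVneq k l; first by exists (incidences (J k)), lam.
  have [F [Fk Fl capE]] := capJ k l kl.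
  have scaleE (A : {set E}) (g : E -> R) :
      s^-1 *: \sum_(e in A) g e *: cayley e =
      \sum_(e in A) (g e / s) *: cayley e.
    by rewrite scaler_sumr; apply: eq_bigr => f _; rewrite scalerA mulrC.
  have : (conv cayley (incidences (J k)) `&` conv cayley (incidences (J l)))%classic
      (s^-1 *: \sum_(e in incidences (J k)) lam e *: cayley e).
    split.
      exists (fun e => lam e / s); split; rewrite ?scaleE //.
        by move=> f fJ; rewrite divr_ge0 ?lam_ge0.
      by rewrite -mulr_suml divff.
    exists (fun e => mu e / s); split; rewrite ?eq_lm ?scaleE //.
      by move=> f fJ; rewrite divr_ge0 ?mu_ge0.
    by rewrite -mulr_suml -eq_s divff.
  rewrite capE => -[nu [_ _ nuE]]; exists F, (fun e => s * nu e); split => //.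
  under [RHS]eq_bigr do rewrite -scalerA.
  by rewrite -scaler_sumr -nuE scalerA divff ?scale1r.
have coef k' (g : E -> R) : F \subset incidences (J k') ->
    \sum_(e in incidences (J k')) g e *: cayley e =
      \sum_(e in F) nu e *: cayley e ->
    forall e, (if e \in incidences (J k') then g e else 0) =
              (if e \in F then nu e else 0).
  move=> Fk' gE f; case: ifP => fJ; last first.
    by case: ifP => // /(fintype.subsetP Fk'); rewrite fJ.
  apply/eqP; rewrite -subr_eq0; apply/eqP.
  apply: ((cellJ k').2 (fun e => g e - (if e \in F then nu e else 0))) => //.
  under eq_bigr do rewrite scalerBl.
  rewrite sumrB ((cayley_edge_eq _ _ _ _).1 gE); apply/eqP; rewrite subr_eq0; apply/eqP.
  rewrite [RHS](bigID (mem F)) /= [X in _ = _ + X]big1 ?addr0.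
    rewrite [RHS](eq_bigl (mem F)) => [|h]; last by apply: andb_idl => /(fintype.subsetP Fk').
    by apply: eq_bigr => h hF; rewrite [h \in F]hF.
  by move=> h /andP[_ /negPf ->]; rewrite scale0r.
by rewrite (coef k lam) // (coef l mu) // -eq_lm.
Qed.

End Cayley.

(** * The identity for fine mixed subdivisions *)

Theorem corollary13p10 (R : realType) (n : nat) (hn : (1 <= n)%N)
    (N : nat) (hN : N = (2 ^ n - 1)%N)
    (last : 'I_N) (hlast : nat_of_ord last = (N - 1)%N)
    (T : 'I_N -> {set 'I_n}) (hTinj : injective T)
    (hT : forall S : {set 'I_n}, (exists i, T i = S) <-> S <> finset.set0)
    (hTlast : T last = [set: 'I_n]%SET)
    (m : nat) (J : 'I_m -> {ffun 'I_N -> {set 'I_n}})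
    (hJ : fine_mixed_subdivision R T J) :
  (n`!)%:R / (\prod_(1 <= k < n) (2 ^+ k - 1)) =
    (2 ^+ n - 2) *
      (\sum_(k < m | (1 < #|J k last|)%N)
         \prod_(i < N | (1 < #|J k i|)%N)
           \prod_(j in J k i) ((alpha last (J k) i j)%:R)^-1)
    + \sum_(k < m | #|J k last| == 1%N)
         \prod_(i < N | (1 < #|J k i|)%N)
           \prod_(j in J k i) ((alpha last (J k) i j)%:R)^-1 :> R.
Proof.
have triJ := cayley_cone_triangulation last hn hJ.
have [_ J0T _ _ _] := hJ.
have J0 k i : J k i != finset.set0 by case: (J0T k i).
have cellJ k : cell R last (incidences (J k)) by case: triJ.
have T0 i : T i != finset.set0 by apply/eqP/hT; exists i.
have Tall (S : {set 'I_n}) : S != finset.set0 -> exists i, T i = S.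
  by move/eqP/hT.
pose w k : R := \prod_(i < N | (1 < #|J k i|)%N)
  \prod_(j in J k i) ((alpha last (J k) i j)%:R)^-1.
rewrite -/(w _).
case: (ltnP 1 n) => n1; last first.
  have n_eq1 : n = 1%N by apply/eqP; rewrite eqn_leq n1.
  have N_eq1 : N = 1%N by rewrite hN n_eq1.
  have card1 k i : #|J k i| = 1%N.
    apply/eqP; rewrite eqn_leq card_gt0 J0 andbT.
    by rewrite (leq_trans (max_card _)) // card_ord n_eq1.
  (* For [n = 1] all products are empty, and it remains to see that there is exactly one cell; with
     a single possible edge every cell is rainbow. *)
  have sum1 : \sum_(k < m) 1 = 1 :> R.
    have T0' i : exists j, j \in T i by apply/set0Pn.
    have J0' k i : exists j, (i, j) \in incidences (J k).
      by have /set0Pn[j jJ] := J0 k i; exists j; rewrite inE.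
    have inj0 : injective (fun _ : 'I_n => 0%N).
      by move=> j j' _; apply: ord_inj; have := ltn_ord j; have := ltn_ord j'; lia.
    have low0 i : i != last -> exists2 j, j \in T i & (0 <= 0)%N.
      by move=> _; have [j jT] := T0' i; exists j.
    rewrite -[RHS](rainbow_cell_uniq hTlast triJ T0' J0' inj0 (b := fun=> 0%N) low0).
    apply: eq_bigr => k _; suff -> : rainbow last (fun=> 0%N) (fun=> 0%N)
        (incidences (J k)) by [].
    apply/imset_injP => -[i j] [i' j'] _ _ _; congr (_, _).
      by apply: ord_inj; have := ltn_ord i; have := ltn_ord i'; lia.
    by apply: ord_inj; have := ltn_ord j; have := ltn_ord j'; lia.
  rewrite [\sum_(k < m | (1 < _)%N) _]big_pred0; last by move=> k /=; rewrite card1.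
  rewrite mulr0 add0r [RHS](eq_bigl xpredT); last by move=> k /=; rewrite card1.
  rewrite [RHS](eq_bigr (fun=> 1)) => [|k _]; last first.
    by rewrite /w big_pred0 // => i /=; rewrite card1.
  by rewrite sum1 n_eq1 big_geq // divr1.
have N1_gt0 : (0 < N.-1)%N.
  have := leq_pexp2l (isT : (0 < 2)%N) n1; rewrite hN.
  by move: (2 ^ n)%N => q; rewrite -/(2 ^ 2)%N (_ : 2 ^ 2 = 4)%N //; lia.
have N1_neq0 : (N.-1)%:R != 0 :> R by rewrite pnatr_eq0 -lt0n.
have pow2E : 2 ^+ n - 2 = (N.-1)%:R :> R.
  have : (N.-1 + 2 = 2 ^ n)%N by lia.
  by move/(congr1 (fun q => q%:R : R)); rewrite natrD natrX => <-; rewrite addrK.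
(* The product over all edges adds the singletons [J k i]: each is a leaf with [alpha] equal to 1,
   except at the root, where the edge cuts off all [N - 1] other unbarred vertices. *)
have wE k : \prod_(e in incidences (J k)) (alpha last (J k) e.1 e.2)%:R^-1 =
    (if #|J k last| == 1%N then (N.-1)%:R^-1 else 1) * w k :> R.
  have -> : \prod_(e in incidences (J k)) (alpha last (J k) e.1 e.2)%:R^-1 =
     \prod_i \prod_(j in J k i) (alpha last (J k) i j)%:R^-1 :> R.
    rewrite pair_big_dep /=; apply: eq_bigl => -[i j]; by rewrite inE.
  rewrite (bigID (fun i => (1 < #|J k i|)%N)) /= mulrC; congr (_ * _).
  have single i : ~~ (1 < #|J k i|)%N -> exists j, J k i = [set j]%SET.
    by rewrite -leqNgt => le1; apply/cards1P; rewrite eqn_leq le1 card_gt0 J0.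
  have val i : ~~ (1 < #|J k i|)%N ->
      \prod_(j in J k i) (alpha last (J k) i j)%:R^-1 =
      (if i == last then (N.-1)%:R^-1 else 1) :> R.
    move=> /single[j Jj]; have jG : (i, j) \in incidences (J k).
      by rewrite inE /= Jj !inE.
    rewrite Jj big_set1.
    have -> : alpha last (J k) i j = unbarred (below last (J k) (i, j)).
      exact: (alphaE last (J k) (i, j) hN).
    case: eqP => [il|/eqP il].
      by rewrite (below_root_leaf (cellJ k) jG) // unbarred_nonroot.
    rewrite (below_leaf (cellJ k) jG) // /unbarred.
    rewrite (_ : [set l | _]%SET = [set i]%SET) ?cards1 ?invr1 //.
    by apply/setP => l; rewrite !inE.
  rewrite (eq_bigr _ val) -big_mkcondr /=.
  case: ifP => J1.
    rewrite (big_pred1 last) // => i /=.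
    by case: eqP => [->|]; rewrite ?andbF // (eqP J1).
  rewrite big_pred0 // => i; case: eqP => [->|]; rewrite ?andbF // andbT -leqNgt.
  have := J0 k last; rewrite -card_gt0; move: J1; case: #|_| => // -[|c] //.
have hooks := sum_hooks hN hTinj Tall hTlast T0 (fun k => J0 k) triJ n1.
have -> : (n`!)%:R / \prod_(1 <= k < n) (2 ^+ k - 1) =
    (N.-1)%:R * \sum_k \prod_(e in incidences (J k))
      (alpha last (J k) e.1 e.2)%:R^-1 :> R.
  rewrite hooks mulrA mulfV // mul1r /order_total prednK //.
  by rewrite -[in LHS](prednK hn) factS prednK // natrM mulrA.
(* When [J k last] is a singleton, its factor [1 / (N - 1)] cancels the global factor
   [2 ^ n - 2]. *)
rewrite pow2E (bigID (fun k => (1 < #|J k last|)%N)) /= mulrDr; congr (_ + _).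
  congr (_ * _); apply: eq_bigr => k J1.
  by rewrite wE gtn_eqF // mul1r.
rewrite mulr_sumr; apply: eq_big => [k|k J1].
  by rewrite -leqNgt eqn_leq card_gt0 J0 andbT.
by rewrite wE eqn_leq card_gt0 J0 andbT leqNgt J1 mulrA mulfV // mul1r.
Qed.
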